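(* For any decorated tree $T$, one has $S(T)\in\mathcal{B}$. Furthermore, if the root of $T$ is decorated with an equality symbol, then $S(T)\in\mathcal{A}$. In both cases, denoting by $\tilde V_T$ the number of vertices of $T$ that are not gray (i.e. that are black or white), one has $d_{S(T)}\le\tilde V_T$. As a consequence, for any decorated tree $T$, the evaluation $S(T)(\frac14)$ is a polynomial in $1/\pi$ with rational coefficients and degree at most $\lfloor\tilde V_T/2\rfloor$.
   Context: A decorated tree is a finite rooted tree $T$ in which each vertex $v$ carries a triple $(\varepsilon_v,\bowtie_v,K_v)\in\{-1,0,1\}\times\{=,\le,\ge,\varnothing\}\times\mathbb{Z}$. Vertices with $\varepsilon_v=-1,0,1$ are called black, gray, white respectively (the coloring need not be proper). Write $v'\le_T v$ if $v'$ is a descendant of $v$ (including $v'=v$). Attach a variable $m_b$ to each black vertex $b$ and a variable $\ell_w$ to each white vertex $w$ (none to gray vertices). To each vertex $v$ associate the condition $$(C_v)\quad \Big(\sum_{w\le_T v,\ \varepsilon_w=1}\ell_w-\sum_{b\le_T v,\ \varepsilon_b=-1}m_b\Big)\ \bowtie_v\ \sum_{v'\le_T v}K_{v'},$$ which is void (always satisfied) if $\bowtie_v=\varnothing$. With $\mathrm{Cat}_n=\frac1{n+1}\binom{2n}{n}$, define the power series $$S(T)=S(T)(t)=\sum_{(\ell_w),(m_b)}\ \prod_{w:\varepsilon_w=1}\mathrm{Cat}_{\ell_w}t^{\ell_w}\prod_{b:\varepsilon_b=-1}\mathrm{Cat}_{m_b}t^{m_b}\prod_{v}\mathbf 1[C_v],$$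 the sum being over tuples of nonnegative integers. It converges at $t=1/4$. For real $a,b,c$ with $c$ not a nonpositive integer, ${}_2F_1(a,b;c;z)=\sum_{n\ge0}\frac{(a)_n(b)_n}{(c)_n}\frac{z^n}{n!}$ with $(x)_n=x(x+1)\cdots(x+n-1)$. Set $H_1(t)={}_2F_1(-\tfrac12,-\tfrac12;1;16t^2)$, $H_2(t)={}_2F_1(-\tfrac12,\tfrac12;2;16t^2)$, $\mathcal{A}=\mathbb{Q}[t,t^{-1},H_1(t),H_2(t)]$, $\mathcal{B}=\mathcal{A}[\sqrt{1-4t}]$, viewed as algebras of Laurent series in $t$. The degree $d_b$ of $b\in\mathcal{B}$ is the minimal degree of a polynomial expression of $b$ in $H_1(t),H_2(t),\sqrt{1-4t}$ with coefficients in $\mathbb{Q}[t,t^{-1}]$, where $H_1(t)$ and $H_2(t)$ are given degree $2$, $\sqrt{1-4t}$ is given degree $1$, and Laurent polynomials in $t$ have degree $0$. *)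

(* Defs.v *)
From HB Require Import structures.
From mathcomp Require Import all_boot all_order all_algebra.
From mathcomp Require Import mpoly.
From mathcomp Require Import boolp ring.
Set Implicit Arguments.
Unset Strict Implicit.
Unset Printing Implicit Defensive.
Import GRing.Theory Num.Theory.
Local Open Scope ring_scope.

Record fps := Fps { coef : nat -> rat }.

Lemma fpsP (f g : fps) : coef f =1 coef g <-> f = g.
Proof.
by split=> [|-> //]; case: f => f; case: g => g /= fg; congr Fps; apply/funext.
Qed.

Lemma coefK : cancel coef Fps. Proof. by case. Qed.
HB.instance Definition _ := Choice.copy fps (can_type coefK).

Definition fps0 : fps := Fps (fun=> 0).
Definition fps_opp (f : fps) : fps := Fps (fun n => - coef f n).
Definition fps_add (f g : fps) : fps := Fps (fun n => coef f n + coef g n).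

Lemma fps_addA : associative fps_add.
Proof. by move=> f g h; apply/fpsP => n /=; rewrite addrA. Qed.
Lemma fps_addC : commutative fps_add.
Proof. by move=> f g; apply/fpsP => n /=; rewrite addrC. Qed.
Lemma fps_add0 : left_id fps0 fps_add.
Proof. by move=> f; apply/fpsP => n /=; rewrite add0r. Qed.
Lemma fps_addN : left_inverse fps0 fps_opp fps_add.
Proof. by move=> f; apply/fpsP => n /=; rewrite addNr. Qed.

HB.instance Definition _ :=
  GRing.isZmodule.Build fps fps_addA fps_addC fps_add0 fps_addN.

Definition fps1 : fps := Fps (fun n => (n == 0%N)%:R).
Definition fps_mul (f g : fps) : fps :=
  Fps (fun n => \sum_(i < n.+1) coef f i * coef g (n - i)%N).

Definition fps_trunc (m : nat) (f : fps) : {poly rat} := \poly_(i < m) coef f i.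

Lemma coef_mul_trunc (f g : fps) m n : (n < m)%N ->
  coef (fps_mul f g) n = (fps_trunc m f * fps_trunc m g)`_n.
Proof.
move=> nm; rewrite coefM /=; apply: eq_bigr => i _; rewrite !coef_poly.
by rewrite (leq_ltn_trans (leq_ord i) nm) (leq_ltn_trans (leq_subr i n) nm).
Qed.

Lemma fps_mulC : commutative fps_mul.
Proof.
by move=> f g; apply/fpsP => n; rewrite !(@coef_mul_trunc _ _ n.+1)// mulrC.
Qed.

Lemma fps_mulA : associative fps_mul.
Proof.
move=> f g h; apply/fpsP => n; pose t := fps_trunc n.+1.
have E (u v w : fps) : coef (fps_mul u (fps_mul v w)) n = (t u * (t v * t w))`_n.
  rewrite coefM /=; apply: eq_bigr => i _; rewrite coef_poly ltn_ord.
  by rewrite -coef_mul_trunc // ltnS leq_subr.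
by rewrite E (fps_mulC _ h) E mulrCA mulrC mulrCA mulrA.
Qed.

Lemma fps_mul1 : left_id fps1 fps_mul.
Proof.
move=> f; apply/fpsP => n /=; rewrite big_ord_recl /= mul1r subn0 big1 ?addr0 //.
by move=> i _; rewrite mul0r.
Qed.

Lemma fps_mulD : left_distributive fps_mul fps_add.
Proof.
move=> f g h; apply/fpsP => n /=; rewrite -big_split /=.
by apply: eq_bigr => i _; rewrite mulrDl.
Qed.

Lemma fps1_neq0 : fps1 != 0 :> fps.
Proof. by apply/eqP => /fpsP /(_ 0%N) /= /eqP; rewrite oner_eq0. Qed.

HB.instance Definition _ := GRing.Zmodule_isComNzRing.Build fps
  fps_mulA fps_mulC fps_mul1 fps_mulD fps1_neq0.

(* The inverse is obtained by choice; invertibility has its general meaning. *)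
Definition fps_unit : {pred fps} := fun f => `[< exists g : fps, g * f = 1 >].
Definition fps_inv (f : fps) : fps :=
  if pselect (exists g : fps, g * f = 1) is left e then projT1 (cid e) else f.

Lemma fps_mulV : {in fps_unit, left_inverse 1 fps_inv *%R}.
Proof.
move=> f /asboolP e; rewrite /fps_inv; case: pselect => // e'.
by case: (cid e').
Qed.
Lemma fps_unitPl (f g : fps) : g * f = 1 -> fps_unit f.
Proof. by move=> gf; apply/asboolP; exists g. Qed.
Lemma fps_inv_out : {in [predC fps_unit], fps_inv =1 id}.
Proof. by move=> f /asboolPn e; rewrite /fps_inv; case: pselect. Qed.

HB.instance Definition _ := GRing.ComNzRing_hasMulInverse.Build fps
  fps_mulV fps_unitPl fps_inv_out.

Lemma fps_low (f : fps) : f != 0 ->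
  exists2 i, coef f i != 0 & forall j, (j < i)%N -> coef f j = 0.
Proof.
move=> f0; have ex : exists i, coef f i != 0.
  apply: contrapT => h; case/eqP: f0; apply/fpsP => i /=.
  by apply/eqP; apply: contrapT => fi; apply: h; exists i; apply/negP.
case: (ex_minnP ex) => i fi mini; exists i => // j ji.
by apply/eqP; apply: contraLR ji => /mini; rewrite -leqNgt.
Qed.

Lemma fps_idomain : GRing.integral_domain_axiom fps.
Proof.
move=> f g fg; apply: contraT; rewrite negb_or.
move=> /andP[/fps_low[i fi mini] /fps_low[j gj minj]].
have /fpsP/(_ (i + j)%N) /= := fg.
have ltij : (i < (i + j).+1)%N by rewrite ltnS leq_addr.
rewrite (bigD1 (Ordinal ltij)) //= addKn big1 ?addr0.
  by move/eqP; rewrite mulf_eq0 (negPf fi) (negPf gj).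
move=> k /eqP ki; case: (ltngtP k i) => [/mini ->|ik|e].
- by rewrite mul0r.
- rewrite [coef g _]minj ?mulr0 //.
  by rewrite ltn_subLR ?ltn_add2r //; exact: leq_ord k.
- by case: ki; apply: val_inj.
Qed.

HB.instance Definition _ :=
  GRing.ComUnitRing_isIntegral.Build fps fps_idomain.

(* Q((t)) is the field of fractions of Q[[t]]. *)
Notation laurent := {fraction fps}.
Notation to_laurent := (@FracField.tofrac fps).

Definition fps_of_poly (p : {poly rat}) : fps := Fps (fun n => p`_n).

Definition is_laurent_poly (x : laurent) : Prop :=
  exists (p : {poly rat}) (k : nat),
    x = to_laurent (fps_of_poly p) / to_laurent (fps_of_poly 'X) ^+ k.

Definition rising (x : rat) (n : nat) : rat := \prod_(i < n) (x + i%:R).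

Definition hyp2F1 (a b c : rat) : fps :=
  Fps (fun n => rising a n * rising b n / rising c n / n`!%:R).

(* f(16 t^2) *)
Definition subst_16t2 (f : fps) : fps :=
  Fps (fun n => if odd n then 0 else coef f n./2 * 16%:R ^+ n./2).

Definition H1 : fps := subst_16t2 (hyp2F1 (- 2%:R^-1) (- 2%:R^-1) 1).
Definition H2 : fps := subst_16t2 (hyp2F1 (- 2%:R^-1) 2%:R^-1 2%:R).

(* Binomial series (1 - z)^(1/2) = sum_n (-1/2)_n z^n / n! at z = 4t. *)
Definition sqrt_1m4t : fps :=
  Fps (fun n => rising (- 2%:R^-1) n * 4%:R ^+ n / n`!%:R).

Lemma sqrt_1m4t0 : coef sqrt_1m4t 0 = 1.
Proof. by rewrite /= /rising big_ord0 !mul1r. Qed.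

Lemma sqrt_1m4t_rec n :
  n.+1%:R * coef sqrt_1m4t n.+1 = (4%:R * n%:R - 2%:R) * coef sqrt_1m4t n.
Proof.
rewrite /= /rising big_ord_recr /= exprS factS natrM.
set r := \prod_(i < n) _; set e := _ ^+ n.
have f0 : n`!%:R != 0 :> rat by rewrite pnatr_eq0 -lt0n fact_gt0.
have n0 : n.+1%:R != 0 :> rat by rewrite pnatr_eq0.
have -> : - 2%:R^-1 + n%:R = (4%:R * n%:R - 2%:R) / 4%:R :> rat by field.
by field; rewrite nat1r n0 f0.
Qed.

Lemma sqrt_1m4t_sqr : sqrt_1m4t ^+ 2 = fps_of_poly (1 - 4%:R *: 'X).
Proof.
rewrite expr2; set s := sqrt_1m4t; set f := s * s.
have sym n : 2%:R * (\sum_(i < n.+1) i%:R * (coef s i * coef s (n - i)%N)) =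
    n%:R * coef f n.
  rewrite mulr_natl mulr2n {2}(reindex_inj rev_ord_inj) -big_split /= mulr_sumr.
  apply: eq_bigr => i _; rewrite subSS subKn ?leq_ord //.
  rewrite (mulrC (coef s (n - i)%N)) -mulrDl -natrD subnKC ?leq_ord //.
have rec n : n.+1%:R * coef f n.+1 = (4%:R * n%:R - 4%:R) * coef f n.
  rewrite -sym big_ord_recl mul0r add0r.
  have fE : coef f n = \sum_(i < n.+1) coef s i * coef s (n - i)%N by [].
  rewrite mulrBl -mulrA -sym fE !mulr_sumr -sumrB.
  apply: eq_bigr => i _; rewrite [nat_of_ord (lift ord0 i)]add1n subSS.
  by rewrite (mulrA i.+1%:R) sqrt_1m4t_rec -/s; ring.
have f0 : coef f 0 = 1 by rewrite [LHS]big_ord1 subnn !sqrt_1m4t0 mulr1.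
have f1 : coef f 1 = - 4%:R.
  by have := rec 0%N; rewrite f0 mulr0 sub0r mulr1 mul1r.
have fS n : coef f n.+2 = 0.
  elim: n => [|n IHn]; first by have /eqP := rec 1%N;
    rewrite mulr1 subrr mul0r mulf_eq0 pnatr_eq0 => /eqP.
  by have /eqP := rec n.+2; rewrite IHn mulr0 mulf_eq0 pnatr_eq0 => /eqP.
apply/fpsP => n; rewrite [RHS]/= coefB coef1 coefZ coefX.
by case: n => [|[|n]]; rewrite ?f0 ?f1 ?fS ?mulr0 ?mulr1 ?subr0 ?sub0r.
Qed.

Definition laurent_poly_coefs (n : nat) (P : {mpoly laurent[n]}) : Prop :=
  forall m : 'X_{1..n}, is_laurent_poly P@_m.

Definition genA (i : 'I_2) : laurent :=
  to_laurent (nth 0 [:: H1; H2] i).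
Definition genB (i : 'I_3) : laurent :=
  to_laurent (nth 0 [:: H1; H2; sqrt_1m4t] i).

Definition in_A (x : laurent) : Prop :=
  exists P : {mpoly laurent[2]}, laurent_poly_coefs P /\ x = P.@[genA].

Definition in_B (x : laurent) : Prop :=
  exists p : {poly laurent},
    (forall i, in_A p`_i) /\ x = p.[to_laurent sqrt_1m4t].

Definition genB_weight (i : 'I_3) : nat := nth 0%N [:: 2; 2; 1]%N i.

(* The zero polynomial gets degree 0. *)
Definition wdeg (P : {mpoly laurent[3]}) : nat :=
  \max_(m <- msupp P) \sum_(i < 3) (m i * genB_weight i)%N.

Definition expresses (P : {mpoly laurent[3]}) (x : laurent) : Prop :=
  laurent_poly_coefs P /\ x = P.@[genB].

Definition has_degB (x : laurent) (d : nat) : Prop :=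
  (exists P, expresses P x /\ wdeg P = d) /\
  (forall P, expresses P x -> (d <= wdeg P)%N).

Variant color := Black | Gray | White.
Variant cmp := CmpEq | CmpLe | CmpGe | CmpVoid.

Definition is_black (c : color) := if c is Black then true else false.
Definition is_gray (c : color) := if c is Gray then true else false.
Definition is_white (c : color) := if c is White then true else false.

Definition cmp_holds (c : cmp) (a b : int) : bool :=
  match c with
  | CmpEq => a == b
  | CmpLe => a <= b
  | CmpGe => a >= b
  | CmpVoid => true
  end.

(* A rooted tree is given by its parent map, which fixes the root and whose
   iterates send every vertex to the root. *)
Record dtree := DTree {
  vertex : finType;
  troot : vertex;
  parent : vertex -> vertex;
  parent_root : parent troot = troot;
  parent_connect : forall v, fconnect parent v troot;
  vcolor : vertex -> color;
  vcmp : vertex -> cmp;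
  vK : vertex -> int
}.

Section TreeSeries.
Variable T : dtree.
Implicit Types v : vertex T.

Definition desc v' v : bool := fconnect (@parent T) v' v.

(* The non-gray vertices, which index the variables l_w and m_b. *)
Definition var : finType := {v : vertex T | ~~ is_gray (vcolor v)}.

Definition condition (x : var -> nat) v : bool :=
  cmp_holds (vcmp v)
    (\sum_(w : var | desc (val w) v && is_white (vcolor (val w))) (x w)%:Z
     - \sum_(b : var | desc (val b) v && is_black (vcolor (val b))) (x b)%:Z)
    (\sum_(v' | desc v' v) vK v').

Definition catalan (n : nat) : rat := 'C(n.*2, n)%:R / n.+1%:R.

(* A tuple contributes to t^N when its entries sum to N, so that each entry
   is at most N. *)
Definition tree_series : fps :=
  Fps (fun N : nat =>
    \sum_(x : {ffun var -> 'I_N.+1} |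
            (\sum_w x w == N)%N && [forall v, condition (fun w => x w) v])
      \prod_w catalan (x w)).

Definition num_nongray : nat := #|[pred v : vertex T | ~~ is_gray (vcolor v)]|.
End TreeSeries.

(* Main.v *)
From HB Require Import structures.
Require Import Defs.
From mathcomp Require Import all_boot all_order all_algebra.
From mathcomp Require Import boolp ring lra zify.
From mathcomp Require mpoly.
Set Implicit Arguments.
Unset Strict Implicit.
Unset Printing Implicit Defensive.
Import Order.TTheory GRing.Theory Num.Theory.
Local Open Scope ring_scope.

(* Put p = t u and q = t / u and let u mark the difference between the white and
   the black variables.  The series of a down-closed set of vertices is a power
   series in p and q; disjoint unions of such sets correspond to products, a
   vertex contributes a factor Cat(p) or Cat(q), and the condition at a vertex
   keeps only the monomials whose u-degree satisfies it.

   Let x = sqrt(1 - 4p), y = sqrt(1 - 4q), and let W and W' be the parts of xy of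
   nonnegative and nonpositive u-degree.  The coefficients of xy in u satisfy a
   three-term recurrence, hence are combinations of H1 and H2.  The algebra
   generated by x, y, W, W', H1, H2 over Laurent polynomials in p and q is stable
   under truncation: the powers of W and W' have one-sided support, so that their
   coefficients are finite sums, and since W + W' = xy + H1 the relations
     (W + W' - H1)^2 = (1 - 4p)(1 - 4q),   y (W + W' - H1) = (1 - 4q) x
   determine, by finite differences, the mixed monomials from the extreme ones.
   At u = 1 one has x = y = s := sqrt(1 - 4t) and W = W' = (s^2 + H1) / 2.

   At t = 1/4 all series converge absolutely, s vanishes, H1 = 4/pi by Gauss's
   contiguity relation together with Wallis' product, and H2 = 2 H1 / 3. *)

(** * Bivariate series *)

(** Truncation is linear but not multiplicative, so that adjoining [W] and [W'], the truncations of
    [xy], could call for further generators at each new product. The critical products are the mixed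
    monomials [W^i W'^j], whose coefficients in [u] are a priori infinite sums. Give [x] and [y]
    weight 1, and [W], [W'], [H1], [H2] weight 2: the relations then trade mixed monomials for
    monomials with fewer factors [W], [W'] and no greater weight, which is what makes an induction
    possible. Since [Cat(p) = (1 - x) / (2p)] has weight 1, the weight of the final series is
    bounded by the number of non-gray vertices. A single coefficient in [u] of an element of the
    algebra involves neither [x], [y] nor [W], [W'], but only [H1] and [H2]; hence the sharper
    statement for an equality at the root. The only divisions are by [p], [q] and nonzero rationals,
    hence Laurent polynomials as coefficients. At [t = 1/4] the generator of weight 1 vanishes and
    those of weight 2 become rational multiples of [1/pi]: this is where the degree is halved. *)

Record pseries (R : Type) := Pseries { pscoef : nat -> R }.

Section PowerSeries.
Variable R : comNzRingType.
Implicit Types f g h : pseries R.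

Lemma pseriesP f g : pscoef f =1 pscoef g <-> f = g.
Proof.
by split=> [|-> //]; case: f => f; case: g => g /= fg; congr Pseries; apply/funext.
Qed.

Lemma pscoefK : cancel (@pscoef R) (@Pseries R). Proof. by case. Qed.
HB.instance Definition _ := Choice.copy (pseries R) (can_type pscoefK).

Definition ps_add f g := Pseries (fun n => pscoef f n + pscoef g n).
Definition ps_opp f := Pseries (fun n => - pscoef f n).
Definition ps_const (c : R) := Pseries (fun n => if n is 0 then c else 0).
Definition ps_mul f g :=
  Pseries (fun n => \sum_(i < n.+1) pscoef f i * pscoef g (n - i)%N).

Fact ps_addA : associative ps_add.
Proof. by move=> f g h; apply/pseriesP => n /=; rewrite addrA. Qed.
Fact ps_addC : commutative ps_add.
Proof. by move=> f g; apply/pseriesP => n /=; rewrite addrC. Qed.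
Fact ps_add0 : left_id (Pseries (fun=> 0)) ps_add.
Proof. by move=> f; apply/pseriesP => n /=; rewrite add0r. Qed.
Fact ps_addN : left_inverse (Pseries (fun=> 0)) ps_opp ps_add.
Proof. by move=> f; apply/pseriesP => n /=; rewrite addNr. Qed.

HB.instance Definition _ :=
  GRing.isZmodule.Build (pseries R) ps_addA ps_addC ps_add0 ps_addN.

Let trunc m f : {poly R} := \poly_(i < m) pscoef f i.

(** Up to a given order, products of series are products of polynomials; commutativity and
    associativity are inherited in this way. *)
Let coef_trunc f g m n : (n < m)%N ->
  pscoef (ps_mul f g) n = (trunc m f * trunc m g)`_n.
Proof.
move=> nm; rewrite coefM /=; apply: eq_bigr => i _; rewrite !coef_poly.
by rewrite (leq_ltn_trans (leq_ord i) nm) (leq_ltn_trans (leq_subr i n) nm).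
Qed.

Fact ps_mulC : commutative ps_mul.
Proof.
by move=> f g; apply/pseriesP => n; rewrite !(@coef_trunc _ _ n.+1)// mulrC.
Qed.

Fact ps_mulA : associative ps_mul.
Proof.
move=> f g h; apply/pseriesP => n; pose t := trunc n.+1.
have E u v w : pscoef (ps_mul u (ps_mul v w)) n = (t u * (t v * t w))`_n.
  rewrite coefM /=; apply: eq_bigr => i _; rewrite coef_poly ltn_ord.
  by rewrite -coef_trunc // ltnS leq_subr.
by rewrite E (ps_mulC _ h) E mulrCA mulrC mulrCA mulrA.
Qed.

Fact ps_mul1 : left_id (ps_const 1) ps_mul.
Proof.
move=> f; apply/pseriesP => n /=; rewrite big_ord_recl /= mul1r subn0.
by rewrite big1 ?addr0 // => i _; rewrite mul0r.
Qed.

Fact ps_mulD : left_distributive ps_mul ps_add.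
Proof.
move=> f g h; apply/pseriesP => n /=; rewrite -big_split /=.
by apply: eq_bigr => i _; rewrite mulrDl.
Qed.

Fact ps1_neq0 : ps_const 1 != 0 :> pseries R.
Proof. by apply/eqP => /pseriesP /(_ 0%N) /= /eqP; rewrite oner_eq0. Qed.

HB.instance Definition _ := GRing.Zmodule_isComNzRing.Build (pseries R)
  ps_mulA ps_mulC ps_mul1 ps_mulD ps1_neq0.

Lemma pscoefD f g n : pscoef (f + g) n = pscoef f n + pscoef g n. Proof. by []. Qed.
Lemma pscoefN f n : pscoef (- f) n = - pscoef f n. Proof. by []. Qed.
Lemma pscoefM f g n :
  pscoef (f * g) n = \sum_(i < n.+1) pscoef f i * pscoef g (n - i)%N.
Proof. by []. Qed.
Lemma pscoef_sum I (r : seq I) (Q : pred I) (F : I -> pseries R) n :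
  pscoef (\sum_(i <- r | Q i) F i) n = \sum_(i <- r | Q i) pscoef (F i) n.
Proof. by apply: (big_morph (fun f => pscoef f n)). Qed.
End PowerSeries.

(* With [p = a t] and [q = t], the monomial [a^i t^N] is [p^i q^(N-i)] and has
   degree [2i - N] in [u]. *)
Notation bps := (pseries {poly rat}).

Definition cf (f : bps) N i := (pscoef f N)`_i.
Definition udeg (N i : nat) : int := i.*2%:Z - N%:Z.

Lemma bpsP (f g : bps) : (forall N i, cf f N i = cf g N i) -> f = g.
Proof. by move=> fg; apply/pseriesP => N; apply/polyP => i; exact: fg. Qed.

Lemma cfD f g N i : cf (f + g) N i = cf f N i + cf g N i.
Proof. by rewrite /cf pscoefD coefD. Qed.
Lemma cfN f N i : cf (- f) N i = - cf f N i.
Proof. by rewrite /cf pscoefN coefN. Qed.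
Lemma cfB f g N i : cf (f - g) N i = cf f N i - cf g N i.
Proof. by rewrite cfD cfN. Qed.
Lemma cfM f g N i : cf (f * g) N i =
  \sum_(M < N.+1) \sum_(k < i.+1) cf f M k * cf g (N - M) (i - k).
Proof.
by rewrite /cf pscoefM coef_sum; apply: eq_bigr => M _; rewrite coefM.
Qed.
Lemma cf_sum I (r : seq I) (Q : pred I) (F : I -> bps) N i :
  cf (\sum_(k <- r | Q k) F k) N i = \sum_(k <- r | Q k) cf (F k) N i.
Proof. by rewrite /cf pscoef_sum coef_sum. Qed.

(** The bound by the size keeps every homogeneous component a polynomial; past it the coefficients
    vanish anyway, so that [cf_sel] needs no side condition. *)
Definition sel (B : int -> bool) (f : bps) : bps := Pseries (fun N =>
  \poly_(i < size (pscoef f N)) (if B (udeg N i) then (pscoef f N)`_i else 0)).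

Lemma cf_sel B f N i : cf (sel B f) N i = if B (udeg N i) then cf f N i else 0.
Proof.
by rewrite /cf coef_poly; case: ltnP => // h; rewrite nth_default //; case: ifP.
Qed.

Lemma eq_sel B B' f : B =1 B' -> sel B f = sel B' f.
Proof. by move=> BB'; apply: bpsP => N i; rewrite !cf_sel BB'. Qed.
Lemma selD B f g : sel B (f + g) = sel B f + sel B g.
Proof. by apply: bpsP => N i; rewrite !(cf_sel, cfD); case: ifP => _; rewrite ?addr0. Qed.
Lemma sel_sel B B' f : sel B (sel B' f) = sel (fun k => B k && B' k) f.
Proof. by apply: bpsP => N i; rewrite !cf_sel; case: (B _); case: (B' _). Qed.
Lemma selT f : sel (fun=> true) f = f.
Proof. by apply: bpsP => N i; rewrite cf_sel. Qed.

Definition homog (e : int) f := forall N i, cf f N i != 0 -> udeg N i = e.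

(** Multiplication by a series of [u]-degree [e] translates degrees by [e]. In particular every
    truncation is linear over the series of degree 0. *)
Lemma sel_homM B e f g : homog e f ->
  sel B (f * g) = f * sel (fun k => B (e + k)) g.
Proof.
move=> he; apply: bpsP => N i; rewrite cf_sel !cfM -[0](mul0r 0).
rewrite [LHS](_ : _ = \sum_(M < N.+1) \sum_(k < i.+1)
   if B (udeg N i) then cf f M k * cf g (N - M) (i - k) else 0); last first.
  case: ifP => // _; rewrite mul0r big1 // => M _; by rewrite big1.
apply: eq_bigr => M _; apply: eq_bigr => k _; rewrite cf_sel.
have [->|/he <-] := eqVneq (cf f M k) 0; first by rewrite !mul0r if_same.
have -> : udeg M k + udeg (N - M) (i - k) = udeg N i.
  by rewrite /udeg; have := ltn_ord M; have := ltn_ord k; lia.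
by case: ifP => _; rewrite ?mulr0.
Qed.

Definition kst (c : rat) : bps := ps_const c%:P.
Definition bp : bps := Pseries (fun N => if N is 1 then 'X else 0).
Definition bq : bps := Pseries (fun N => if N is 1 then 1 else 0).

Lemma cf_kstM c f N i : cf (kst c * f) N i = c * cf f N i.
Proof.
rewrite /cf pscoefM big_ord_recl big1 ?addr0 ?subn0 ?coefCM //.
by move=> k _; rewrite mul0r.
Qed.

Lemma cf_kst c N i : cf (kst c) N i = if (N == 0%N) && (i == 0%N) then c else 0.
Proof. by rewrite /cf; case: N => [|N] /=; rewrite ?coef0 ?coefC. Qed.

Lemma kstD c d : kst (c + d) = kst c + kst d.
Proof.
by apply: bpsP => N i; rewrite cfD !cf_kst; case: ifP => _; rewrite ?addr0.
Qed.
Lemma kstM c d : kst (c * d) = kst c * kst d.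
Proof.
by apply: bpsP => N i; rewrite cf_kstM !cf_kst; case: ifP => _; rewrite ?mulr0.
Qed.
Lemma kst1 : kst 1 = 1. Proof. by []. Qed.
Lemma kst0 : kst 0 = 0.
Proof. by apply: bpsP => N i; rewrite cf_kst if_same /cf coef0. Qed.
Lemma kstN c : kst (- c) = - kst c.
Proof. by apply: bpsP => N i; rewrite cfN !cf_kst; case: ifP => _; rewrite ?oppr0. Qed.
Lemma kst_nat n : kst n%:R = n%:R.
Proof. by elim: n => [|n IH]; rewrite ?kst0 // -natr1 kstD IH kst1 natr1. Qed.

Lemma cf_bpM f N i : cf (bp * f) N i =
  if (N, i) is (N'.+1, i'.+1) then cf f N' i' else 0.
Proof.
rewrite /cf pscoefM; case: N => [|N]; first by rewrite big_ord1 mul0r coef0.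
rewrite big_ord_recl mul0r add0r big_ord_recl /= subn1 big1 => [|k _]; last by rewrite mul0r.
by rewrite addr0 coefXM; case: i.
Qed.

Lemma cf_bqM f N i : cf (bq * f) N i = if N is N'.+1 then cf f N' i else 0.
Proof.
rewrite /cf pscoefM; case: N => [|N]; first by rewrite big_ord1 mul0r coef0.
rewrite big_ord_recl mul0r add0r big_ord_recl /= subn1 big1 => [|k _]; last by rewrite mul0r.
by rewrite addr0 mul1r.
Qed.

Lemma cf_bpqM f N i : cf (bp * (bq * f)) N i =
  if (N, i) is (N'.+2, i'.+1) then cf f N' i' else 0.
Proof. by rewrite cf_bpM; case: N i => [|[|N]] [|i]; rewrite // cf_bqM. Qed.

Lemma homog_kst c : homog 0 (kst c).
Proof. by move=> [|N] [|i]; rewrite cf_kst /= ?eqxx. Qed.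
Lemma homog_bp : homog 1 bp.
Proof.
move=> N i; rewrite -[bp]mulr1 cf_bpM; case: N i => [|N] [|i]; rewrite ?eqxx //.
by rewrite -kst1 cf_kst; case: N i => [|N] [|i]; rewrite /= ?eqxx.
Qed.
Lemma homog_bq : homog (-1) bq.
Proof.
move=> N i; rewrite -[bq]mulr1 cf_bqM; case: N => [|N]; rewrite ?eqxx //.
by rewrite -kst1 cf_kst; case: N i => [|N] [|i]; rewrite /= ?eqxx.
Qed.

(** Homogeneity means being fixed by the selection of a single degree, so that [sel_homM]
    applies. *)
Lemma homogM e e' f g : homog e f -> homog e' g -> homog (e + e') (f * g).
Proof.
move=> hf hg N i; rewrite -[f * g]selT.
have -> : f * g = sel (fun k => k == e + e') (f * g).
  rewrite (sel_homM _ _ hf); congr (f * _); apply: bpsP => M j.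
  rewrite cf_sel (inj_eq (addrI e)); case: ifP => /= [|/negbT] /eqP //.
  by have [->|/hg] := eqVneq (cf g M j) 0.
by rewrite selT cf_sel; case: ifP => [/eqP/=->|]; rewrite ?eqxx.
Qed.

(* An even series [f(t)], read in [t^2 = p q]. *)
Definition lift_diag (f : fps) : bps :=
  Pseries (fun N => if odd N then 0 else coef f N *: 'X^(N./2)).

Lemma cf_diag f N i : cf (lift_diag f) N i = if N == i.*2 then coef f N else 0.
Proof.
rewrite /cf /=; have [oN|eN] := boolP (odd N).
  by rewrite coef0; case: eqP => // eN; rewrite eN odd_double in oN.
rewrite coefZ coefXn -{3}(even_halfK eN) (inj_eq double_inj) eq_sym.
by case: eqP => _; rewrite ?mulr1 ?mulr0.
Qed.

Lemma homog_diag f : homog 0 (lift_diag f).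
Proof.
move=> N i; rewrite cf_diag; case: ifP => [/eqP->|]; last by rewrite eqxx.
by rewrite /udeg subrr.
Qed.

Definition h1 := lift_diag H1.
Definition h2 := lift_diag H2.

(* [f(p)] if [c], and [f(q)] otherwise. *)
Definition embed (c : bool) (f : fps) : bps :=
  Pseries (fun N => coef f N *: 'X^(c * N)).

Lemma embedM c f g : embed c (f * g) = embed c f * embed c g.
Proof.
apply/pseriesP => N; rewrite pscoefM /= scaler_suml; apply: eq_bigr => k _.
rewrite -scalerAl -scalerAr scalerA -exprD -mulnDr subnKC //.
by rewrite -ltnS.
Qed.

Lemma cf_embed c f N i :
  cf (embed c f) N i = if i == (c * N)%N then coef f N else 0.
Proof. by rewrite /cf /= coefZ coefXn; case: eqP; rewrite ?mulr1 ?mulr0. Qed.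

Definition bX := embed true sqrt_1m4t.
Definition bY := embed false sqrt_1m4t.

Lemma bX_sqr : bX ^+ 2 = 1 - 4%:R * bp.
Proof.
rewrite expr2 -embedM -expr2 sqrt_1m4t_sqr -kst_nat -kst1.
apply: bpsP => N i; rewrite cf_embed cfB cf_kstM -[bp]mulr1 cf_bpM -kst1 cf_kst.
rewrite /= mul1n coefB coef1 coefZ coefX.
case: N i => [|[|N]] [|[|i]] //=; rewrite ?cf_kst ?subr0 ?mulr0 ?if_same //=.
Qed.

Lemma bY_sqr : bY ^+ 2 = 1 - 4%:R * bq.
Proof.
rewrite expr2 -embedM -expr2 sqrt_1m4t_sqr -kst_nat -kst1.
apply: bpsP => N i; rewrite cf_embed cfB cf_kstM -[bq]mulr1 cf_bqM -kst1 cf_kst.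
rewrite /= mul0n coefB coef1 coefZ coefX.
case: N i => [|[|N]] [|i] //=; rewrite ?cf_kst ?subr0 ?mulr0 ?if_same //=.
Qed.

(** * The product [xy] and its coefficients in [u] *)

Definition bP := bX * bY.

Lemma cf_bP N i : cf bP N i =
  if (i <= N)%N then coef sqrt_1m4t i * coef sqrt_1m4t (N - i) else 0.
Proof.
rewrite /cf pscoefM coef_sum.
have E (k : 'I_N.+1) : (pscoef bX k * pscoef bY (N - k))`_i =
    if i == k then coef sqrt_1m4t i * coef sqrt_1m4t (N - i) else 0.
  rewrite /= mul1n mul0n expr0 -scalerAl -scalerAr mulr1 !coefZ coefXn.
  by case: eqP => [->|_]; rewrite ?mulr1 ?mulr0 // mulrC.
under eq_bigr do rewrite E.
case: leqP => iN; last first.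
  by rewrite big1 // => k _; case: eqP => // ik; rewrite ik ltnNge -ltnS ltn_ord in iN.
rewrite (bigD1 (inord i)) // inordK // eqxx big1 => [|k]; first exact: addr0.
move=> ki; case: (i =P k) => // ik; case/eqP: ki; apply: val_inj.
by rewrite /= inordK.
Qed.

Definition diag (k : int) f := sel (pred1 k) f.

Lemma cf_diagP k N i : cf (diag k bP) N i = if (udeg N i == k) && (i <= N)%N
  then coef sqrt_1m4t i * coef sqrt_1m4t (N - i) else 0.
Proof. by rewrite cf_sel cf_bP /=; case: (udeg N i == k). Qed.

(** This is the coefficient of [u^k] in the differential equation [2 Q F' = Q' F], where [F = xy],
    [Q = F^2 = 1 + 16 t^2 - 4 t (u + 1/u)] and the prime is [u d/du]. It is checked on monomials: at
    [p^i q^j] with [i - j = k], the recurrence of the square root turns all terms into rational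
    multiples of one product of coefficients, and a rational identity in [i] and [j] remains. *)
Lemma diagP_rec (k : int) :
  kst (2 * k + 3)%:~R * (bq * diag (k + 1) bP) =
  kst (k%:~R / 2%:R) * (diag k bP + kst 16%:R * (bp * (bq * diag k bP)))
  - kst (2 * k - 3)%:~R * (bp * diag (k - 1) bP).
Proof.
apply: bpsP => N i; rewrite cfB !(cf_kstM, cfD) cf_bpqM cf_bpM cf_bqM.
(* Every term is homogeneous of [u]-degree [k], so that all coefficients vanish in the other
   degrees. *)
have [Eu|nE] := eqVneq (udeg N i) k; last first.
  have F N' i' l : udeg N' i' - l = udeg N i - k -> cf (diag l bP) N' i' = 0.
    move=> e; rewrite cf_diagP; case: eqP => //= El.
    by case/eqP: nE; move: e; rewrite El subrr => /esym/eqP; rewrite subr_eq0 => /eqP.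
  case: N i nE F => [|[|N]] [|i] nE F; rewrite !F;
   rewrite ?mulr0 ?addr0 ?subr0 ?oppr0 //; rewrite /udeg.
  all: try (clear; lia).
have H n : coef sqrt_1m4t n.+1 = (4%:R * n%:R - 2%:R) / n.+1%:R * coef sqrt_1m4t n.
  have n0 : n.+1%:R != 0 :> rat by rewrite pnatr_eq0.
  by rewrite mulrAC -sqrt_1m4t_rec mulrAC mulfV // mul1r.
have F N' i' l : udeg N' i' - l = udeg N i - k -> cf (diag l bP) N' i' =
    if (i' <= N')%N then coef sqrt_1m4t i' * coef sqrt_1m4t (N' - i') else 0.
  by rewrite Eu subrr => /subr0_eq El; rewrite cf_diagP El eqxx.
have [iN|Ni] := leqP i N; last first.
  case: N i Eu Ni F => [|[|N]] [|i] Eu Ni F //; rewrite !F; try (clear; rewrite /udeg; lia).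
  all: do ?[rewrite ifF; last by apply/negbTE; rewrite -ltnNge; lia].
  all: try by rewrite ?mulr0 ?addr0 ?subr0 ?mulr0.
move: (coef sqrt_1m4t) H F => s H F.
have Ek : k%:~R = i%:R - (N - i)%:R :> rat.
  rewrite -Eu /udeg natrB // -addnn PoszD !intrD intrN -!pmulrn; ring.
rewrite !intrD !intrN !intrM -!pmulrn Ek.
have [j EN] : exists j, N = (i + j)%N by exists (N - i)%N; rewrite subnKC.
move: EN Eu iN F Ek => -> Eu iN F _; rewrite addKn.
have nz n : n.+1%:R != 0 :> rat by rewrite pnatr_eq0.
case: i j Eu iN F => [|i] [|j] Eu iN F; rewrite ?(addSn, addnS, add0n, addn0) in F *.
- by rewrite !(subr0, mulr0, mul0r).
- rewrite !F; try (clear; rewrite /udeg; lia).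
  rewrite !subn0 !leq0n H -natr1.
  rewrite [X in 16%:R * X](_ : _ = 0) ?mulr0; last by case: (j).
  by field; rewrite natr1 nz.
- have -> : (if i is N'.+1 then cf (diag k bP) N' i else 0) = 0.
    by case: (i) => // m; rewrite cf_diagP ltnn andbF.
  rewrite !F; try (clear; rewrite /udeg; lia).
  rewrite !leqnn ltnn !subnn H -!natr1.
  by field; rewrite natr1 nz.
- rewrite !F; try (clear; rewrite /udeg; lia).
  rewrite !(leq_addr, ltnS, subSS) ?addKn leqW ?leq_addr // !subSn ?leq_addr // addKn.
  rewrite ?addKn !H -!natr1.
  by field; rewrite !natr1 !nz.
Qed.

(** * Stability under truncation *)

Lemma rising_succ n m : rising m.+1%:R n * m`!%:R = (m + n)`!%:R.
Proof.
elim: n => [|n IH]; first by rewrite /rising big_ord0 addn0 mul1r.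
rewrite /rising big_ord_recr /= -/(rising _ _) mulrAC IH addnS factS natrM mulrC.
by rewrite -natrD addSn.
Qed.

Lemma rising_half n : rising (- 2%:R^-1) n.+1 = - 2%:R^-1 * rising 2%:R^-1 n.
Proof.
rewrite /rising big_ord_recl addr0; congr (_ * _); apply: eq_bigr => i _.
by rewrite lift0 -natr1; field.
Qed.

Lemma coef_H1 i : coef H1 i.*2 = coef sqrt_1m4t i ^+ 2.
Proof.
rewrite /= odd_double doubleK.
have := rising_succ i 0; rewrite mulr1 add0n => ->.
have f0 : i`!%:R != 0 :> rat by rewrite pnatr_eq0 -lt0n fact_gt0.
have -> : 16%:R ^+ i = 4%:R ^+ i * 4%:R ^+ i :> rat by rewrite -exprMn -natrM.
by field.
Qed.

(** The identity [(-1/2)_(i+1) = -1/2 (1/2)_i] turns the parameter 1/2 into a shift of the index: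
    [H2] collects products of neighbouring coefficients of the square root, as [H1] collects their
    squares. They are thus the two initial values of [diagP_rec]. *)
Lemma coef_H2 i :
  coef H2 i.*2 = - 2%:R^-1 * (coef sqrt_1m4t i * coef sqrt_1m4t i.+1).
Proof.
rewrite /= odd_double doubleK rising_half.
have := rising_succ i 1; rewrite mulr1 add1n => ->.
have f0 n : n`!%:R != 0 :> rat by rewrite pnatr_eq0 -lt0n fact_gt0.
have -> : 16%:R ^+ i = 4%:R ^+ i * 4%:R ^+ i :> rat by rewrite -exprMn -natrM.
by rewrite exprS; field; rewrite !f0.
Qed.

Lemma diagP0 : diag 0 bP = h1.
Proof.
apply: bpsP => N i; rewrite cf_diagP cf_diag.
have -> : (udeg N i == 0) = (N == i.*2) by rewrite /udeg; lia.
case: eqP => // ->; rewrite andTb coef_H1 -addnn leq_addr addnK expr2 //.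
Qed.

Lemma diagP1 : diag 1 bP = kst (- 2%:R) * (bp * h2).
Proof.
apply: bpsP => N i; rewrite cf_diagP cf_kstM cf_bpM.
case: N i => [|N] [|i]; rewrite ?mulr0 ?andbF //.
rewrite cf_diag.
have -> : (udeg N.+1 i.+1 == 1) = (N == i.*2) by rewrite /udeg; lia.
case: eqP => [->|_]; last by rewrite mulr0.
rewrite andTb coef_H2 ltnS -addnn leq_addr subSS addnK; by field.
Qed.

Definition pos_part f := sel (fun k => 0 <= k) f.
Definition neg_part f := sel (fun k => k <= 0) f.
Definition bW := pos_part bP.
Definition bWn := neg_part bP.

(** The two parts overlap in [u]-degree 0, where [xy] equals [h1]. *)
Lemma bW_sum : bW + bWn = bP + h1.
Proof.
rewrite -diagP0; apply: bpsP => N i; rewrite !cfD !cf_sel /=.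
by case: (ltgtP (udeg N i) 0) => _; rewrite ?addr0 ?add0r.
Qed.

(** * Algebras with a degree filtration *)

(* [E d f] adjoins [f] as a generator of degree [d]. *)
Inductive gen (E : nat -> bps -> Prop) : nat -> bps -> Prop :=
| gen_kst c : gen E 0 (kst c)
| gen_p : gen E 0 bp
| gen_q : gen E 0 bq
| gen_h1 : gen E 2 h1
| gen_h2 : gen E 2 h2
| gen_extra d f : E d f -> gen E d f
| gen_add d f g : gen E d f -> gen E d g -> gen E d (f + g)
| gen_mul d e f g : gen E d f -> gen E e g -> gen E (d + e) (f * g)
| gen_le d e f : (d <= e)%N -> gen E d f -> gen E e f.

(* Powers of [p q] clear the denominators of Laurent polynomials. *)
Definition lgen E d f := exists N, gen E d ((bp * bq) ^+ N * f).

Section Gen.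
Variable E : nat -> bps -> Prop.

Lemma gen_pq N : gen E 0 ((bp * bq) ^+ N).
Proof.
elim: N => [|N IH]; first by rewrite expr0 -kst1; apply: gen_kst.
by rewrite exprS; apply: (@gen_mul E 0 0) => //; apply: (@gen_mul E 0 0); constructor.
Qed.

Lemma lgen_pq N d f : lgen E d ((bp * bq) ^+ N * f) -> lgen E d f.
Proof. by move=> [M]; rewrite mulrA -exprD => h; exists (M + N)%N. Qed.

(** Division by [p] costs one more power of [p q], the surplus factor [q] being a generator. *)
Lemma lgen_p d f : lgen E d (bp * f) -> lgen E d f.
Proof.
move=> [M h]; exists M.+1; rewrite exprS (_ : _ * f = bq * ((bp * bq) ^+ M * (bp * f))); last by ring.
by apply: (@gen_mul E 0 d) h; exact: gen_q.
Qed.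

Lemma lgen_q d f : lgen E d (bq * f) -> lgen E d f.
Proof.
move=> [M h]; exists M.+1; rewrite exprS (_ : _ * f = bp * ((bp * bq) ^+ M * (bq * f))); last by ring.
by apply: (@gen_mul E 0 d) h; exact: gen_p.
Qed.

Lemma lgen_gen d f : gen E d f -> lgen E d f.
Proof. by move=> h; exists 0%N; rewrite expr0 mul1r. Qed.

Lemma lgen_le d e f : (d <= e)%N -> lgen E d f -> lgen E e f.
Proof. by move=> de [N h]; exists N; exact: gen_le h. Qed.

Lemma lgen_mul d e f g : lgen E d f -> lgen E e g -> lgen E (d + e) (f * g).
Proof.
move=> [N hf] [M hg]; exists (N + M)%N; rewrite exprD mulrACA.
exact: gen_mul.
Qed.

Lemma lgen_add d f g : lgen E d f -> lgen E d g -> lgen E d (f + g).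
Proof.
move=> [N hf] [M hg]; exists (N + M)%N; rewrite mulrDr; apply: gen_add.
  by rewrite exprD mulrAC mulrC; apply: (@gen_mul E 0 d) hf; exact: gen_pq.
by rewrite exprD -mulrA; apply: (@gen_mul E 0 d) hg; exact: gen_pq.
Qed.

Lemma lgen_kstM d c f : lgen E d f -> lgen E d (kst c * f).
Proof. by apply: (@lgen_mul 0 d); apply: lgen_gen; exact: gen_kst. Qed.

Lemma lgen0 d : lgen E d 0.
Proof. by rewrite -kst0; apply: (lgen_le (leq0n d)); apply: lgen_gen; exact: gen_kst. Qed.

Lemma lgenN d f : lgen E d f -> lgen E d (- f).
Proof. by move=> h; rewrite -mulN1r -kst1 -kstN; exact: lgen_kstM. Qed.

Lemma lgenB d f g : lgen E d f -> lgen E d g -> lgen E d (f - g).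
Proof. by move=> hf hg; apply: lgen_add => //; exact: lgenN. Qed.

Lemma lgen_sum d I (r : seq I) (Q : pred I) (F : I -> bps) :
  (forall i, Q i -> lgen E d (F i)) -> lgen E d (\sum_(i <- r | Q i) F i).
Proof.
move=> h; elim/big_rec: _ => [|i f Qi hf]; first exact: lgen0.
by apply: lgen_add => //; exact: h.
Qed.

Lemma lgen_kstK d c f : c != 0 -> lgen E d (kst c * f) -> lgen E d f.
Proof.
by move=> c0 /(lgen_kstM c^-1); rewrite mulrA -kstM mulVf // kst1 mul1r.
Qed.
End Gen.

Lemma gen_mono (E E' : nat -> bps -> Prop) d f :
  (forall e g, E e g -> E' e g) -> gen E d f -> gen E' d f.
Proof.
move=> EE'; elim=> [c|||||e g /EE'|||]; try by constructor.
- by move=> {}d e {}f de _ hf; exact: gen_le hf.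
Qed.

(** At [u = 1] the base algebra lands in [A], and the full one, defined below, in [B]. *)
Notation base_gen := (gen (fun _ _ => False)).
Notation base_lgen := (lgen (fun _ _ => False)).

Variant ext_gens : nat -> bps -> Prop :=
| ext_x : ext_gens 1 bX
| ext_y : ext_gens 1 bY
| ext_W : ext_gens 2 bW
| ext_W' : ext_gens 2 bWn.
Notation full_gen := (gen ext_gens).
Notation full_lgen := (lgen ext_gens).

Lemma lgenAB d f : base_lgen d f -> full_lgen d f.
Proof. by move=> [N h]; exists N; apply: gen_mono h. Qed.

(** The recurrence is run upwards by dividing by [(2k + 3) q] and downwards by dividing by
    [(2k - 3) p]; these integers are odd, hence nonzero. The degree stays 2, since all the
    multipliers have degree 0. *)
Lemma lgenA_diagP k : base_lgen 2 (diag k bP).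
Proof.
pose rec := diagP_rec.
have stepU j : base_lgen 2 (diag j bP) -> base_lgen 2 (diag (j - 1) bP) ->
    base_lgen 2 (diag (j + 1) bP).
  move=> hj hj1; apply: lgen_q; apply: (@lgen_kstK _ _ (2 * j + 3)%:~R).
    by rewrite intr_eq0; lia.
  rewrite rec; apply: lgenB; apply: lgen_kstM.
    apply: lgen_add => //; apply: lgen_kstM; rewrite mulrA -[bp * bq]expr1.
    by apply: (@lgen_mul _ 0 2) => //; apply: lgen_gen; exact: gen_pq.
  by apply: (@lgen_mul _ 0 2) => //; apply: lgen_gen; exact: gen_p.
have stepD j : base_lgen 2 (diag j bP) -> base_lgen 2 (diag (j + 1) bP) ->
    base_lgen 2 (diag (j - 1) bP).
  move=> hj hj1; apply: lgen_p; apply: (@lgen_kstK _ _ (2 * j - 3)%:~R).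
    by rewrite intr_eq0; lia.
  rewrite (_ : _ * _ = kst (j%:~R / 2%:R) *
      (diag j bP + kst 16%:R * (bp * (bq * diag j bP)))
    - kst (2 * j + 3)%:~R * (bq * diag (j + 1) bP)); last first.
    by rewrite rec opprB addrCA subrr addr0.
  apply: lgenB; apply: lgen_kstM.
    apply: lgen_add => //; apply: lgen_kstM; rewrite mulrA -[bp * bq]expr1.
    by apply: (@lgen_mul _ 0 2) => //; apply: lgen_gen; exact: gen_pq.
  by apply: (@lgen_mul _ 0 2) => //; apply: lgen_gen; exact: gen_q.
have h0 : base_lgen 2 (diag 0 bP) by rewrite diagP0; apply: lgen_gen; constructor.
have hp1 : base_lgen 2 (diag 1 bP).
  rewrite diagP1; apply: lgen_kstM; apply: (@lgen_mul _ 0 2); apply: lgen_gen; constructor.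
have hU (n : nat) : base_lgen 2 (diag n%:Z bP) /\ base_lgen 2 (diag n.+1%:Z bP).
  elim: n => [|n [IH1 IH2]]; first by split.
  split=> //; rewrite (_ : n.+2%:Z = n.+1%:Z + 1); last by lia.
  by apply: stepU => //; rewrite (_ : n.+1%:Z - 1 = n%:Z) //; lia.
have hD (n : nat) : base_lgen 2 (diag (- n%:Z) bP) /\ base_lgen 2 (diag (1 - n%:Z) bP).
  elim: n => [|n [IH1 IH2]]; first by split; rewrite ?oppr0 ?subr0.
  split; last by rewrite (_ : 1 - n.+1%:Z = - n%:Z) //; lia.
  rewrite (_ : - n.+1%:Z = - n%:Z - 1); last by lia.
  by apply: stepD => //; rewrite addrC.
by case: (intP k) => [|n|n]; [|case: (hU n.+1)|case: (hD n.+1)].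
Qed.

(** * Series with truncations in the algebra *)

(** Lower thresholds suffice: upper ones are complements of them. Single coefficients, which serve
    the equalities, are required to lie in the base algebra, without loss of degree. *)
Definition good d f := [/\ full_lgen d f, forall K : int, full_lgen d (sel (fun k => K <= k) f)
  & forall k, base_lgen d (diag k f)].

Lemma good_le d e f : (d <= e)%N -> good d f -> good e f.
Proof.
by move=> de [h1 h2 h3]; split=> *; apply: (lgen_le de).
Qed.

Lemma good_add d f g : good d f -> good d g -> good d (f + g).
Proof.
move=> [f1 f2 f3] [g1 g2 g3]; split=> [|K|k]; rewrite /diag ?selD.
- exact: lgen_add.
- by apply: lgen_add; [apply: f2|apply: g2].
- by apply: lgen_add; [apply: f3|apply: g3].
Qed.

Lemma good_homM m d e f g : homog e f -> base_lgen m f -> good d g -> good (m + d) (f * g).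
Proof.
move=> hf Af [g1 g2 g3]; have Bf := lgenAB Af; split=> [|K|k].
- exact: lgen_mul.
- rewrite (sel_homM _ _ hf); apply: lgen_mul => //.
  rewrite (@eq_sel _ (fun k => K - e <= k)) // => k; by rewrite lerBlDl.
- rewrite /diag (sel_homM _ _ hf); apply: lgen_mul => //.
  rewrite (@eq_sel _ (pred1 (k - e))) => [|l /=]; first exact: g3.
  by rewrite [RHS]eq_sym subr_eq addrC eq_sym.
Qed.

(** Good series form a module over the base algebra: an element of it need not be homogeneous, but
    its generators are, and each of them only shifts the thresholds. *)
Lemma good_genA m d f g : base_gen m f -> good d g -> good (m + d) (f * g).
Proof.
move=> hf; elim: hf d g => {m f} [c|||||//|m f f' _ IH _ IH'|m m' f f' _ IH _ IH'|m m' f mm' _ IH] d g hg.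
- by apply: (good_homM (@homog_kst c)) hg; apply: lgen_gen; constructor.
- by apply: (good_homM homog_bp) hg; apply: lgen_gen; constructor.
- by apply: (good_homM homog_bq) hg; apply: lgen_gen; constructor.
- by apply: (good_homM (@homog_diag _)) hg; apply: lgen_gen; constructor.
- by apply: (good_homM (@homog_diag _)) hg; apply: lgen_gen; constructor.
- by rewrite mulrDl; apply: good_add; [apply: IH|apply: IH'].
- by rewrite -mulrA -addnA; apply: IH; exact: IH'.
- by apply: (@good_le (m + d)); rewrite ?leq_add2r //; exact: IH.
Qed.

Lemma good_kstM d c f : good d f -> good d (kst c * f).
Proof. by apply: (@good_genA 0); constructor. Qed.

Lemma goodN d f : good d f -> good d (- f).
Proof. by rewrite -mulN1r -kst1 -kstN; exact: good_kstM. Qed.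

Lemma goodB d f g : good d f -> good d g -> good d (f - g).
Proof. by move=> hf /goodN; exact: good_add. Qed.

Lemma good_nat d n f : good d f -> good d (n%:R * f).
Proof. by rewrite -kst_nat; exact: good_kstM. Qed.

Lemma good_natK d n f : good d (n.+1%:R * f) -> good d f.
Proof.
move=> /(good_kstM n.+1%:R^-1); rewrite -kst_nat mulrA -kstM mulVf ?mul1r //.
by rewrite pnatr_eq0.
Qed.

(** Modulo good series consecutive terms are opposite, so that one good term propagates in both
    directions. *)
Lemma good_diff1 d m (c : nat -> bps) :
  (forall i, (i < m)%N -> good d (c i + c i.+1)) ->
  forall k, (k <= m)%N -> good d (c k) -> forall i, (i <= m)%N -> good d (c i).
Proof.
move=> h k km gk; have down j : (j <= k)%N -> good d (c (k - j)%N).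
  elim: j => [|j IH] jk; first by rewrite subn0.
  have -> : c (k - j.+1)%N = c (k - j.+1)%N + c (k - j.+1).+1 - c (k - j)%N.
    by rewrite subnSK // addrK.
  by apply: goodB; [apply: h; lia|apply: IH; lia].
have up j : (k + j <= m)%N -> good d (c (k + j)%N).
  elim: j => [|j IH] jk; first by rewrite addn0.
  have -> : c (k + j.+1)%N = c (k + j)%N + c (k + j).+1 - c (k + j)%N.
    by rewrite addnS addrAC subrr add0r.
  by apply: goodB; [apply: h; lia|apply: IH; lia].
move=> i im; have [ik|/ltnW ki] := leqP i k.
  by rewrite -(subKn ik); apply: down; lia.
by rewrite -(subnKC ki); apply: up; lia.
Qed.

(* With alternating signs the second differences of [c] are good, so [c] is
   affine modulo good series and is determined by its two end values. *)
Lemma good_diff2 d m (c : nat -> bps) :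
  (forall i, (i.+1 < m)%N -> good d (c i + 2%:R * c i.+1 + c i.+2)) ->
  good d (c 0%N) -> good d (c m) -> forall i, (i <= m)%N -> good d (c i).
Proof.
move=> h g0 gm; case: m => [|m] in h gm *.
  by move=> i; rewrite leqn0 => /eqP ->.
pose b i := (-1) ^+ i * c i.
have sgn n f : good d f -> good d ((-1) ^+ n * f).
  by move=> hf; rewrite -signr_odd mulr_sign; case: (odd n); [exact: goodN|].
have gb i : (i < m.+1)%N -> good d (b i - b 0%N - i%:R * (b 1%N - b 0%N)) /\
    good d (b i.+1 - b 0%N - i.+1%:R * (b 1%N - b 0%N)).
  elim: i => [|i IH] im.
    split; rewrite ?mul0r ?mul1r !subrr ?subr0; rewrite -(subrr (c 0%N)); exact: goodB.
  have [IH1 IH2] := IH (ltnW im); split=> //.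
  rewrite (_ : _ - _ = (-1) ^+ i * (c i + 2%:R * c i.+1 + c i.+2)
     + 2%:R * (b i.+1 - b 0%N - i.+1%:R * (b 1%N - b 0%N))
     - (b i - b 0%N - i%:R * (b 1%N - b 0%N))).
    apply: goodB => //; apply: good_add; last exact: good_nat.
    by apply: sgn; apply: h.
  by rewrite /b !exprS -[in LHS]natr1 -!natr1; ring.
(* The last value determines the slope up to the factor [m + 1], which is invertible in the
   rationals. *)
have g1 : good d (b 1%N - b 0%N).
  apply: (@good_natK _ m).
  rewrite (_ : _ * _ = b m.+1 - b 0%N - (b m.+1 - b 0%N - m.+1%:R * (b 1%N - b 0%N))).
    by apply: goodB; [apply: goodB; exact: sgn|apply: (gb m _).2].
  by rewrite subKr.
move=> [//|i] im; rewrite (_ : c i.+1 = (-1) ^+ i.+1 * b i.+1).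
  apply: (sgn); rewrite (_ : b _ = b i.+1 - b 0%N - i.+1%:R * (b 1%N - b 0%N)
     + i.+1%:R * (b 1%N - b 0%N) + b 0%N); last by rewrite !subrK.
  apply: good_add; last exact: sgn.
  by apply: good_add; [apply: (gb i _).2|exact: good_nat].
by rewrite /b mulrA -exprD addnn -signr_odd odd_double mul1r.
Qed.

(** * Series supported on one side *)

(** The sign [e] is 1 for supports in nonnegative degrees ([x], [W]) and -1 for nonpositive ones
    ([y], [W']). *)
Definition side (e : int) f := forall N i, cf f N i != 0 -> 0 <= e * udeg N i.

(** When both supports lie on the same side, only finitely many splittings of [k] contribute. If [k]
    lies on the other side, the second factor of each term vanishes. *)
Lemma diag_sideM (e k : int) f g : e \in [:: 1; -1] -> side e f -> side e g ->
  diag k (f * g) = \sum_(a < `|k|.+1) diag (e * a%:Z) f * diag (k - e * a%:Z) g.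
Proof.
move=> he sf sg; apply: bpsP => N i; rewrite cf_sum /=.
under eq_bigr do rewrite cfM.
rewrite exchange_big cf_sel cfM /=.
rewrite [LHS](_ : _ = \sum_(M < N.+1) if udeg N i == k then
  \sum_(j < i.+1) cf f M j * cf g (N - M) (i - j) else 0); last first.
  by case: eqP => // _; rewrite big1.
apply: eq_bigr => M _; rewrite exchange_big /=.
rewrite [LHS](_ : _ = \sum_(j < i.+1) if udeg N i == k then
  cf f M j * cf g (N - M) (i - j) else 0); last first.
  by case: eqP => // _; rewrite big1.
apply: eq_bigr => j _; under eq_bigr do rewrite !cf_sel /=.
have Eu : udeg M j + udeg (N - M) (i - j) = udeg N i.
  by rewrite /udeg; have := ltn_ord M; have := ltn_ord j; lia.
have [->|nf] := eqVneq (cf f M j) 0.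
  by rewrite mul0r if_same big1 // => a _; rewrite if_same mul0r.
have [->|ng] := eqVneq (cf g (N - M) (i - j)) 0.
  by rewrite mulr0 if_same big1 // => a _; rewrite if_same mulr0.
move: (sf _ _ nf) (sg _ _ ng); move: (udeg M j) (udeg (N - M) (i - j)) (udeg N i) Eu => u v w Eu hu hv.
case: eqP => [wk|wk]; last first.
  rewrite big1 // => a _; case: eqP => [ua|]; last by rewrite mul0r.
  by case: eqP => [va|]; [case: wk; rewrite -Eu ua va addrC subrK|rewrite mulr0].
have le : (`|u| < `|k|.+1)%N by move: he; rewrite !inE => /orP[/eqP ee|/eqP ee]; rewrite ee in hu hv; lia.
have eu : u = e * `|u|%:Z by move: he; rewrite !inE => /orP[/eqP ee|/eqP ee]; rewrite ee in hu hv *; lia.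
rewrite (bigD1 (Ordinal le)) //= -eu eqxx ifT; last by apply/eqP; lia.
rewrite big1 ?addr0 // => a na; rewrite ifF ?mul0r //; apply/negbTE.
apply: contraNneq na => ua; apply/eqP/val_inj => /=; rewrite ua.
by move: he; rewrite !inE => /orP[/eqP ee|/eqP ee]; rewrite ee; lia.
Qed.

Definition onesided e d f :=
  [/\ side e f, full_lgen d f & forall k, base_lgen d (diag k f)].

Lemma sideM e f g : side e f -> side e g -> side e (f * g).
Proof.
move=> sf sg N i; rewrite cfM => nz.
have [M /existsP[j]] : exists M : 'I_N.+1, [exists j : 'I_i.+1, cf f M j * cf g (N - M) (i - j) != 0].
  apply/existsP; apply: contraNT nz => /existsPn h; rewrite big1 // => M _.
  rewrite big1 // => j _; have /existsPn := h M.
  by move/(_ j); rewrite negbK => /eqP.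
rewrite mulf_eq0 negb_or => /andP[/sf hf /sg hg].
have <- : udeg M j + udeg (N - M) (i - j) = udeg N i.
  by rewrite /udeg; have := ltn_ord M; have := ltn_ord j; lia.
by rewrite mulrDr addr_ge0.
Qed.

Lemma onesidedM e d d' f g : e \in [:: 1; -1] ->
  onesided e d f -> onesided e d' g -> onesided e (d + d') (f * g).
Proof.
move=> he [f1 f2 f3] [g1 g2 g3]; split; first exact: sideM.
  exact: lgen_mul.
move=> k; rewrite (diag_sideM _ he f1 g1); apply: lgen_sum => a _.
by apply: lgen_mul; [apply: f3|apply: g3].
Qed.

Lemma diag1 k : diag k 1 = if k == 0 then 1 else 0.
Proof.
apply: bpsP => N i; rewrite cf_sel -kst1 /=.
have [E0|] := eqVneq (cf (kst 1) N i) 0; first by rewrite E0; do !case: ifP; rewrite ?E0 // /cf coef0.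
by move/homog_kst => ->; rewrite eq_sym; case: ifP => // _; rewrite /cf coef0.
Qed.

Lemma onesided1 e : onesided e 0 1.
Proof.
split; [|by apply: lgen_gen; rewrite -kst1; constructor|move=> k; rewrite diag1].
  by move=> N i; rewrite -kst1 => /homog_kst ->; rewrite mulr0.
by case: ifP => _; [apply: lgen_gen; rewrite -kst1; constructor|exact: lgen0].
Qed.

Lemma onesidedX e d f n : e \in [:: 1; -1] ->
  onesided e d f -> onesided e (n * d) (f ^+ n).
Proof.
move=> he hf; elim: n => [|n IH]; first by rewrite expr0; exact: onesided1.
by rewrite exprS mulSn; exact: onesidedM.
Qed.

(** A threshold affects finitely many degrees on one side: for nonnegative support the degrees below
    [K] are subtracted, for nonpositive support those from [K] to 0 are summed. *)
Lemma onesided_good e d f : e \in [:: 1; -1] -> onesided e d f -> good d f.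
Proof.
rewrite !inE => he [f1 f2 f3]; split=> // K.
case/orP: he => /eqP ee; rewrite ee in f1.
  have -> : sel (fun k => K <= k) f =
      f - \sum_(a < (if K is Posz n then n else 0%N)) diag a%:Z f.
    apply: bpsP => N i; rewrite cfB cf_sum cf_sel; under eq_bigr do rewrite cf_sel /=.
    have [->|/f1] := eqVneq (cf f N i) 0.
      by rewrite if_same big1 ?subr0 // => a _; rewrite if_same.
    rewrite mul1r; case: (udeg N i) => // u _; case: K => [n|n]; last by rewrite big_ord0 subr0.
    rewrite lez_nat; case: leqP => nu.
      rewrite big1 ?subr0 // => a _; rewrite ifF //; apply/negbTE; have := ltn_ord a; lia.
    rewrite (bigD1 (Ordinal nu)) //= eqxx big1 ?addr0 ?subrr // => a na.
    by rewrite ifF //; apply: contraNF na => /eqP[ua]; apply/eqP/val_inj.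
  by apply: lgenB => //; apply: lgenAB; apply: lgen_sum.
have -> : sel (fun k => K <= k) f =
    \sum_(a < (if K <= 0 then `|K|.+1 else 0%N)) diag (- a%:Z) f.
  apply: bpsP => N i; rewrite cf_sum cf_sel; under eq_bigr do rewrite cf_sel /=.
  have [->|/f1] := eqVneq (cf f N i) 0.
    by rewrite if_same big1 // => a _; rewrite if_same.
  rewrite mulN1r; move: (udeg N i) => u hu.
  have [Ku|uK] := leP K u; last first.
    rewrite big1 // => a _; rewrite ifF //; apply/negbTE; move: (ltn_ord a); move: (nat_of_ord a) => n.
    by case: ifP => ? ?; lia.
  have nu : (`|u| < if (K <= 0)%R then `|K|.+1 else 0%N)%N by case: ifP => ?; lia.
  rewrite (bigD1 (Ordinal nu)) //= ifT; last by apply/eqP; lia.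
  rewrite big1 ?addr0 // => a na.
  by rewrite ifF //; apply: contraNF na => /eqP ua; apply/eqP/val_inj => /=; lia.
by apply: lgenAB; apply: lgen_sum => a _.
Qed.

Lemma cf_bpX n N i : cf (bp ^+ n) N i = if (N == n) && (i == n) then 1 else 0.
Proof.
elim: n N i => [|n IH] N i; first by rewrite expr0 -kst1 cf_kst.
by rewrite exprS cf_bpM; case: N i => [|N] [|i]; rewrite ?IH ?andbF.
Qed.

Lemma cf_bqX n N i : cf (bq ^+ n) N i = if (N == n) && (i == 0%N) then 1 else 0.
Proof.
elim: n N i => [|n IH] N i; first by rewrite expr0 -kst1 cf_kst.
by rewrite exprS cf_bqM; case: N => [|N]; rewrite ?IH.
Qed.

Lemma genA_X f n : base_gen 0 f -> base_gen 0 (f ^+ n).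
Proof.
move=> hf; elim: n => [|n IH]; first by rewrite expr0 -kst1; exact: gen_kst.
by rewrite exprS; exact: (@gen_mul _ 0 0).
Qed.

Lemma onesided_bX : onesided 1 1 bX.
Proof.
split=> [||k].
- move=> N i; rewrite cf_embed mul1n; case: ifP => [/eqP-> _|]; last by rewrite eqxx.
  by rewrite /udeg; lia.
- by apply: lgen_gen; apply: gen_extra; constructor.
case: k => [n|n]; last first.
  rewrite (_ : diag _ _ = 0); first exact: lgen0.
  apply: bpsP => N i; rewrite cf_sel cf_embed mul1n /cf coef0 /=.
  by case: eqP => // e; case: eqP => // ei; rewrite ei /udeg in e; lia.
rewrite (_ : diag _ _ = kst (coef sqrt_1m4t n) * bp ^+ n).
  apply: lgen_kstM; apply: (@lgen_le _ 0) => //; apply: lgen_gen; apply: genA_X.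
  exact: gen_p.
apply: bpsP => N i; rewrite cf_sel cf_embed cf_kstM cf_bpX mul1n.
have [->|ne] := eqVneq i N; last first.
  by rewrite if_same; case: ifP => [/andP[/eqP eN /eqP ei]|]; rewrite ?mulr0 //; rewrite eN ei eqxx in ne.
rewrite andbb; have -> : pred1 n%:Z (udeg N N) = (N == n) by rewrite /= /udeg; lia.
by case: eqP => [->|]; rewrite ?mulr1 ?mulr0.
Qed.

Lemma onesided_bY : onesided (-1) 1 bY.
Proof.
split=> [||k].
- move=> N i; rewrite cf_embed mul0n; case: ifP => [/eqP-> _|]; last by rewrite eqxx.
  by rewrite /udeg; lia.
- by apply: lgen_gen; apply: gen_extra; constructor.
have [k0|k0] := lerP k 0; last first.
  rewrite (_ : diag _ _ = 0); first exact: lgen0.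
  apply: bpsP => N i; rewrite cf_sel cf_embed mul0n /cf coef0 /=.
  by case: eqP => // e; case: eqP => // ei; rewrite ei /udeg in e; lia.
rewrite (_ : diag _ _ = kst (coef sqrt_1m4t `|k|) * bq ^+ `|k|).
  apply: lgen_kstM; apply: (@lgen_le _ 0) => //; apply: lgen_gen; apply: genA_X.
  exact: gen_q.
apply: bpsP => N i; rewrite cf_sel cf_embed cf_kstM cf_bqX mul0n.
have [->|ne] := eqVneq i 0%N; last by rewrite if_same andbF mulr0.
rewrite andbT; have -> : pred1 k (udeg N 0) = (N == `|k|%N) by rewrite /= /udeg; lia.
by case: eqP => [->|]; rewrite ?mulr1 ?mulr0.
Qed.

Lemma onesided_part (e : int) f : e \in [:: 1; -1] ->
  full_lgen 2 (sel (fun k => 0 <= e * k) f) -> (forall k, base_lgen 2 (diag k f)) ->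
  onesided e 2 (sel (fun k => 0 <= e * k) f).
Proof.
move=> he hB hA; split=> // [N i|k]; first by rewrite cf_sel; case: ifP; rewrite ?eqxx.
rewrite /diag sel_sel; case ek : (0 <= e * k).
  rewrite (@eq_sel _ (pred1 k)) => [|l /=]; first exact: hA.
  by case: eqP => // ->; rewrite ek.
rewrite (_ : sel _ f = 0); first exact: lgen0.
apply: bpsP => N i; rewrite cf_sel /cf coef0 /=.
by case: eqP => //= ->; rewrite ek.
Qed.

Fact pos_side : (1 : int) \in [:: 1; -1]. Proof. by []. Qed.
Fact neg_side : (-1 : int) \in [:: 1; -1]. Proof. by []. Qed.

Lemma onesided_bW : onesided 1 2 bW.
Proof.
rewrite (_ : bW = sel (fun k => 0 <= 1 * k) bP); last first.
  by apply: eq_sel => k; rewrite mul1r.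
apply: onesided_part => // [|k]; last exact: lgenA_diagP.
rewrite (_ : sel _ _ = bW); last by apply: eq_sel => k; rewrite mul1r.
by apply: lgen_gen; apply: gen_extra; constructor.
Qed.

Lemma onesided_bWn : onesided (-1) 2 bWn.
Proof.
have E : bWn = sel (fun k => 0 <= -1 * k) bP.
  by apply: eq_sel => k; rewrite mulN1r oppr_ge0.
rewrite E; apply: onesided_part => // [|k]; last exact: lgenA_diagP.
by rewrite -E; apply: lgen_gen; apply: gen_extra; constructor.
Qed.

(** * Monomials in [x], [y], [W], [W'] *)

Lemma genA_1m4 f : base_gen 0 f -> base_gen 0 (1 - 4%:R * f).
Proof.
move=> hf; rewrite -kst_nat -mulNr -kstN -kst1; apply: gen_add; first exact: gen_kst.
by apply: (@gen_mul _ 0 0) => //; exact: gen_kst.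
Qed.

(** Multiplied by [W^k W'^l], the relation expresses [W^2 + 2 W W' + W'^2] by terms with fewer
    factors [W], [W'], good by induction; the factors [h1] have degree 2 and at most make up for the
    loss. The end values are powers of a single one-sided series. *)
Lemma good_WW m i j : (i + j = m)%N -> good (2 * m) (bW ^+ i * bWn ^+ j).
Proof.
elim/ltn_ind: m i j => m IH i j ijm.
have g0 : good (2 * m) (bWn ^+ m).
  by rewrite mulnC; apply: (onesided_good neg_side); exact: (onesidedX _ neg_side onesided_bWn).
have gm : good (2 * m) (bW ^+ m).
  by rewrite mulnC; apply: (onesided_good pos_side); exact: (onesidedX _ pos_side onesided_bW).
pose c k := bW ^+ k * bWn ^+ (m - k).
have -> : bW ^+ i * bWn ^+ j = c i by rewrite /c -ijm addKn.
apply: (@good_diff2 _ m c); last by lia.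
  2: by rewrite /c expr0 mul1r subn0.
  2: by rewrite /c subnn expr0 mulr1.
move=> k km; have [l El] : exists l, (m = k + l.+2)%N by exists (m - k - 2)%N; lia.
have Ec r n : (n = m - r)%N -> c r = bW ^+ r * bWn ^+ n by move=> ->.
rewrite (Ec k l.+2) ?(Ec k.+1 l.+1) ?(Ec k.+2 l); try by rewrite El; lia.
rewrite (_ : _ + _ + _ = (1 - 4%:R * bp) * (1 - 4%:R * bq) * (bW ^+ k * bWn ^+ l)
  + 2%:R * (h1 * (bW ^+ k.+1 * bWn ^+ l)) + 2%:R * (h1 * (bW ^+ k * bWn ^+ l.+1))
  - h1 * h1 * (bW ^+ k * bWn ^+ l)); last first.
  rewrite -bX_sqr -bY_sqr.
  have -> : bX ^+ 2 * bY ^+ 2 = (bW + bWn - h1) ^+ 2.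
    by rewrite bW_sum addrK -exprMn.
  by rewrite !exprS; ring.
apply: goodB.
  apply: good_add; last first.
    apply: good_nat; apply: (@good_le (2 + 2 * (k + l.+1))); first by lia.
    by apply: good_genA; [exact: gen_h1|apply: IH; lia].
  apply: good_add; last first.
    apply: good_nat; apply: (@good_le (2 + 2 * (k.+1 + l))); first by lia.
    by apply: good_genA; [exact: gen_h1|apply: IH; lia].
  apply: (@good_le (0 + 2 * (k + l))); first by lia.
  apply: good_genA; last by apply: IH; lia.
  by apply: (@gen_mul _ 0 0); apply: genA_1m4; constructor.
apply: (@good_le (2 + 2 + 2 * (k + l))); first by lia.
apply: good_genA; last by apply: IH; lia.
by apply: gen_mul; constructor.
Qed.

(** Multiplying [W + W' = xy + h1] by [x] gives [(1 - 4p) y + h1 x], and symmetrically for [y]: sums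
    of neighbours lower [m] but exchange [x] and [y], whence the simultaneous induction. A
    first-order relation needs only one end value. *)
Lemma good_xyWW m i j : (i + j = m)%N ->
  good (2 * m + 1) (bX * (bW ^+ i * bWn ^+ j)) /\
  good (2 * m + 1) (bY * (bW ^+ i * bWn ^+ j)).
Proof.
elim: m i j => [|m IH] i j ijm.
  have [-> ->] : i = 0%N /\ j = 0%N by lia.
  rewrite !expr0 !mulr1; split; [apply: (onesided_good pos_side)|apply: (onesided_good neg_side)].
    exact: onesided_bX.
  exact: onesided_bY.
pose c z k : bps := z * (bW ^+ k * bWn ^+ (m.+1 - k)).
have Ec z : z * (bW ^+ i * bWn ^+ j) = c z i by rewrite /c -ijm addKn.
rewrite !Ec.
have rel z k : (k < m.+1)%N -> c z k + c z k.+1 =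
    bX * bY * z * (bW ^+ k * bWn ^+ (m - k)) + h1 * (z * (bW ^+ k * bWn ^+ (m - k))).
  rewrite ltnS => km; rewrite /c subSS (subSn km).
  rewrite (_ : bX * bY = bW + bWn - h1); last by rewrite bW_sum addrK.
  by rewrite !exprS; ring.
have hk k : (k < m.+1)%N -> (k + (m - k))%N = m by lia.
(* The end value is the one whose factors are supported on the same side: [x W^(m+1)] for [x], and
   [y W'^(m+1)] for [y]. *)
split; [apply: (@good_diff1 _ m.+1 (c bX) _ m.+1) => [k km|||]
       |apply: (@good_diff1 _ m.+1 (c bY) _ 0%N) => [k km|||]]; try lia.
- have [hx hy] := IH _ _ (hk _ km).
  rewrite rel // (_ : bX * bY * bX = (1 - 4%:R * bp) * bY); last first.
    by rewrite -bX_sqr; ring.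
  apply: good_add.
    rewrite -mulrA; apply: (@good_le (0 + (2 * m + 1))); first by lia.
    by apply: good_genA => //; apply: genA_1m4; constructor.
  apply: (@good_le (2 + (2 * m + 1))); first by lia.
  by apply: good_genA => //; constructor.
- rewrite /c subnn expr0 mulr1; apply: (onesided_good pos_side).
  rewrite addnC mulnC; exact: (onesidedM pos_side onesided_bX (onesidedX _ pos_side onesided_bW)).
- have [hx hy] := IH _ _ (hk _ km).
  rewrite rel // (_ : bX * bY * bY = (1 - 4%:R * bq) * bX); last first.
    by rewrite -bY_sqr; ring.
  apply: good_add.
    rewrite -mulrA; apply: (@good_le (0 + (2 * m + 1))); first by lia.
    by apply: good_genA => //; apply: genA_1m4; constructor.
  apply: (@good_le (2 + (2 * m + 1))); first by lia.
  by apply: good_genA => //; constructor.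
rewrite /c subn0 expr0 mul1r; apply: (onesided_good neg_side).
rewrite addnC mulnC; exact: (onesidedM neg_side onesided_bY (onesidedX _ neg_side onesided_bWn)).
Qed.

Definition mono a b i j := bX ^+ a * bY ^+ b * (bW ^+ i * bWn ^+ j).

(** The relations for [x^2], [y^2] and [xy = W + W' - h1] leave at most one factor [x] or [y], and
    none of them raises the degree. *)
Lemma good_mono a b i j : good (a + b + 2 * (i + j)) (mono a b i j).
Proof.
have step e f g d d' : e ^+ 2 = 1 - 4%:R * f -> base_gen 0 f -> good d (e ^+ d' * g) ->
   good d.+2 (e ^+ d'.+2 * g).
  move=> ef hf hg; rewrite (_ : _ * g = (1 - 4%:R * f) * (e ^+ d' * g)); last first.
    by rewrite -ef !exprS; ring.
  apply: (@good_le (0 + d)); first by lia.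
  by apply: good_genA => //; exact: genA_1m4.
elim/ltn_ind: a => a IHa; case: a IHa => [|[|a]] IHa; last first.
- rewrite /mono -mulrA !addSn; apply: step bX_sqr _ _; first exact: gen_p.
  by have := IHa a; rewrite /mono -mulrA; apply; lia.
- elim/ltn_ind: b {IHa} => b IHb; case: b IHb => [|[|b]] IHb; last first.
  + rewrite /mono mulrAC mulrC -addnA !addSn !addnS; apply: step bY_sqr _ _; first exact: gen_q.
    by rewrite mulrC mulrAC; have := IHb b; rewrite addSn; apply; lia.
  + rewrite /mono !expr1 -[bX * bY]/bP (_ : bP = bW + bWn - h1); last first.
      by rewrite bW_sum addrK.
    rewrite mulrBl mulrDl; apply: goodB; first apply: good_add.
    * apply: (@good_le (2 * (i.+1 + j))); first by lia.
      by rewrite mulrA -exprS; apply: good_WW.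
    * apply: (@good_le (2 * (i + j.+1))); first by lia.
      by rewrite mulrCA -exprS; apply: good_WW.
    by apply: good_genA; [constructor|exact: good_WW].
  rewrite /mono expr0 mulr1 expr1 addn0 addnC.
  by case: (good_xyWW (erefl (i + j)%N)).
elim/ltn_ind: b {IHa} => b IHb; case: b IHb => [|[|b]] IHb; last first.
- rewrite /mono expr0 mul1r add0n !addSn; apply: step bY_sqr _ _; first exact: gen_q.
  by have := IHb b; rewrite /mono expr0 mul1r; apply; lia.
- rewrite /mono expr0 mul1r expr1 add0n addnC.
  by case: (good_xyWW (erefl (i + j)%N)).
by rewrite /mono !expr0 !mul1r; exact: good_WW.
Qed.

Lemma genB_good d f : full_gen d f -> good d f.
Proof.
move=> hf.
(* Stability under multiplication is what survives induction on products. *)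
pose N d f := forall a b i j, good (d + (a + b + 2 * (i + j))) (f * mono a b i j).
pose N' d f := forall e g, N e g -> N (d + e)%N (f * g).
have N'A m h : base_gen m h -> N' m h.
  by move=> hm e g hg a b i j; rewrite -mulrA -addnA; exact: good_genA.
(* A generator [x], [y], [W] or [W'] is absorbed into the monomials by raising an exponent. *)
have shift m h : (forall a b i j, exists a' b' i' j',
    h * mono a b i j = mono a' b' i' j' /\
    (m + (a + b + 2 * (i + j)) = a' + b' + 2 * (i' + j'))%N) -> N' m h.
  move=> hs e g hg a b i j.
  have [a' [b' [i' [j' [E1 E2]]]]] := hs a b i j.
  rewrite (mulrC h) -mulrA E1 (_ : (_ + _ = e + (a' + b' + 2 * (i' + j')))%N).
    exact: hg.
  by lia.
suff: N' d f.
  have N1 : N 0%N 1 by move=> a b i j; rewrite mul1r; exact: good_mono.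
  by move=> /(_ 0%N 1 N1 0%N 0%N 0%N 0%N); rewrite /mono !expr0 !mulr1 !addn0.
elim: hf => {d f} [c|||||d f []|d f g _ hf _ hg|d d' f g _ hf _ hg|d e f de _ hf].
1-5: by apply: N'A; constructor.
- by apply: shift => a b i j; exists a.+1, b, i, j; rewrite /mono exprS !mulrA; split=> //; lia.
- by apply: shift => a b i j; exists a, b.+1, i, j; rewrite /mono !exprS; split; [ring|lia].
- by apply: shift => a b i j; exists a, b, i.+1, j; rewrite /mono !exprS; split; [ring|lia].
- by apply: shift => a b i j; exists a, b, i, j.+1; rewrite /mono !exprS; split; [ring|lia].
- move=> e h hh a b i j; rewrite mulrDl mulrDl; apply: good_add; [exact: hf|exact: hg].
- by move=> e h hh; rewrite -mulrA -addnA; apply: hf; exact: hg.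
move=> e' h hh a b i j; apply: good_le; last exact: hf.
by rewrite leq_add2r leq_add2r.
Qed.

(** The denominators are powers of [p q], which has [u]-degree 0, and therefore commute with all
    truncations. *)
Lemma lgenB_good d f : full_lgen d f -> good d f.
Proof.
move=> [N /genB_good hg].
have hom : homog 0 ((bp * bq) ^+ N).
  elim: N {hg} => [|N IH]; first by rewrite expr0 -kst1; exact: homog_kst.
  by rewrite exprS; apply: (@homogM 0 0) => //; apply: (@homogM 1 (-1)); [exact: homog_bp|exact: homog_bq].
case: hg => h1 h2 h3; split=> [|K|k]; first exact: lgen_pq h1.
- apply: (@lgen_pq _ N); have := h2 K; rewrite (sel_homM _ _ hom).
  by rewrite (@eq_sel _ (fun k => K <= k)) // => k; rewrite add0r.
apply: (@lgen_pq _ N); have := h3 k; rewrite /diag (sel_homM _ _ hom).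
by rewrite (@eq_sel _ (pred1 k)) // => l; rewrite add0r.
Qed.

Lemma lgenB_cmp d f c (K : int) :
  full_lgen d f -> full_lgen d (sel (fun k => cmp_holds c k K) f).
Proof.
move=> hf; have [_ h2 h3] := lgenB_good hf; case: c => /=.
- by apply: lgenAB; exact: h3.
- rewrite (_ : sel _ f = f - sel (fun k => K + 1 <= k) f); first exact: lgenB.
  apply: bpsP => N i; rewrite cfB !cf_sel lezD1 ltNge.
  by case: (_ <= K); rewrite ?subrr ?subr0.
- exact: h2.
by rewrite selT.
Qed.

(** * Decorated trees *)

Lemma catalan_rec n : (n + 2)%:R * catalan n.+1 = (4 * n + 2)%:R * catalan n.
Proof.
rewrite /catalan doubleS.
have E : (n.+1 * 'C(n.*2.+2, n.+1) = 2 * (n.*2.+1) * 'C(n.*2, n))%N.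
  have e1 := mul_bin_diag n.*2.+2 n; have e2 := mul_bin_down n.*2.+1 n.
  rewrite /= in e1 e2.
  have e3 : (n.*2.+1 - n = n.+1)%N by lia.
  rewrite e3 in e2; rewrite -e1 -doubleS -mul2n -!mulnA; congr (2 * _)%N.
  by rewrite e2.
have nz m : m.+1%:R != 0 :> rat by rewrite pnatr_eq0.
move/(congr1 (fun k => k%:R : rat)): E; rewrite !natrM => E.
have -> : (4 * n + 2)%:R = 2%:R * n.*2.+1%:R :> rat by rewrite -natrM; congr (_%:R); lia.
rewrite addn2 mulrCA divff // mulr1 mulrA -E mulrAC divff ?mul1r //.
Qed.

(** This is [1 - sqrt(1 - 4t) = 2 t Cat(t)] on coefficients: both sides obey the same recurrence of
    order one. *)
Lemma sqrt_catalan n : coef sqrt_1m4t n.+1 = - 2%:R * catalan n.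
Proof.
have nz m : m.+1%:R != 0 :> rat by rewrite pnatr_eq0.
elim: n => [|n IH]; [apply: (mulfI (nz 0%N))|apply: (mulfI (nz n.+1))]; rewrite sqrt_1m4t_rec.
  by rewrite sqrt_1m4t0 /catalan /= divr1; ring.
have := catalan_rec n; rewrite addn2 => E; rewrite IH [RHS]mulrCA E.
by rewrite natrD natrM -[in LHS]natr1; ring.
Qed.

Definition catalan_fps := Fps catalan.

Lemma catalan_lgen c : full_lgen 1 (embed c catalan_fps).
Proof.
have E : kst 2%:R * ((if c then bp else bq) * embed c catalan_fps) =
    1 - (if c then bX else bY).
  apply: bpsP => N i; rewrite cf_kstM cfB -kst1 cf_kst /bX /bY (fun_if (fun f => cf f N i)) !cf_embed.
  move: (coef sqrt_1m4t) sqrt_1m4t0 sqrt_catalan => s s0 sS.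
  case: c; rewrite ?cf_bpM ?cf_bqM.
    case: N i => [|N] [|i]; rewrite ?mul1n ?mulr0 //= ?s0 ?subrr ?subr0 // cf_embed mul1n eqSS sS.
    by case: eqP => _ /=; rewrite ?subr0 ?mulr0 // sub0r mulNr opprK.
  case: N i => [|N] [|i]; rewrite ?cf_embed ?mul0n /= ?s0 ?subr0 ?mulr0 ?subrr //.
  by rewrite sS sub0r mulNr opprK.
have H : full_lgen 1 (kst 2%:R * ((if c then bp else bq) * embed c catalan_fps)).
  rewrite E; apply: lgenB; last by apply: lgen_gen; case: c {E}; apply: gen_extra; constructor.
  by apply: (@lgen_le _ 0) => //; apply: lgen_gen; rewrite -kst1; apply: gen_kst.
have := @lgen_kstK _ _ 2%:R _ isT H.
by case: c {E H} => h; [exact: lgen_p|exact: lgen_q].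
Qed.

Section Tree.
Variable T : dtree.
Implicit Types (u v : vertex T) (w : var T) (A B C D : {set vertex T}).

Lemma desc_refl v : desc v v. Proof. exact: connect0. Qed.
Lemma desc_trans u v v' : desc u v -> desc v v' -> desc u v'.
Proof. exact: connect_trans. Qed.

Lemma iter_root n : iter n (@parent T) (troot T) = troot T.
Proof. by elim: n => //= n ->; exact: parent_root. Qed.

(** Mutual descendants make [u] periodic under the parent map; a multiple of the period exceeding
    the depth of [u] shows that [u] is the root, which is a fixed point. *)
Lemma desc_anti u v : desc u v -> desc v u -> u = v.
Proof.
move=> /iter_findex uv /iter_findex vu; have /iter_findex ur := parent_connect u.
set n := findex _ u v in uv; set m := findex _ v u in vu; set k := findex _ u _ in ur.
have per j : iter (j * (m + n)) (@parent T) u = u.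
  by elim: j => // j IH; rewrite mulSn iterD IH iterD uv.
have [n0|n0] := posnP n; first by rewrite -uv n0.
have le : (k <= k * (m + n))%N by rewrite leq_pmulr // addn_gt0 n0 orbT.
have uroot : u = troot T by rewrite -(per k) -(subnK le) iterD ur iter_root.
by rewrite -uv uroot iter_root.
Qed.

Lemma desc_total u v v' : desc u v -> desc u v' -> desc v v' || desc v' v.
Proof.
move=> /iter_findex <- /iter_findex <-.
move: (findex _ u v) (findex _ u v') => n m; rewrite /desc.
wlog le : n m / (n <= m)%N => [H|]; last by rewrite -(subnK le) iterD fconnect_iter.
by have /orP[/H //|/H] := leq_total n m; rewrite orbC.
Qed.

(** * Series of down-closed sets *)

Definition down_closed A := forall u v, v \in A -> desc u v -> u \in A.

Definition mon w : bps := if is_white (vcolor (val w)) then bp else bq.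
(** Outside [A] the weight forces the variable to be 0, so that all the sums can run over the same
    tuples whatever [A] is. *)
Definition weight A w n : bps :=
  if val w \in A then kst (catalan n) * mon w ^+ n else (n == 0%N)%:R.

(* Bounding the variables by [b] leaves the coefficients of order at most [b]
   unchanged. *)
Definition tgf b A C : bps :=
  \sum_(x : {ffun var T -> 'I_b.+1} | [forall v in C, condition (fun w => x w) v])
    \prod_w weight A w (x w).

Lemma condition_ext (x y : var T -> nat) v :
  (forall w, desc (val w) v -> x w = y w) -> condition x v = condition y v.
Proof.
move=> xy; rewrite /condition.
by congr (cmp_holds _ (_ - _) _); apply: eq_bigr => w /andP[/xy-> _].
Qed.

Definition supported b A (x : {ffun var T -> 'I_b.+1}) :=
  [forall w, (val w \notin A) ==> (x w == ord0)].

Lemma tgf_supp b A C : tgf b A C =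
  \sum_(x : {ffun var T -> 'I_b.+1} | supported A x && [forall v in C, condition (fun w => x w) v])
    \prod_w weight A w (x w).
Proof.
rewrite /tgf big_mkcond [RHS]big_mkcond /=; apply: eq_bigr => x _.
have [//|/forallPn[w]] := boolP (supported A x).
rewrite negb_imply => /andP[wA xw]; rewrite (bigD1 w) //= /weight (negPf wA).
rewrite (_ : (x w : nat) == 0%N = false) ?mul0r ?if_same //.
by apply: negbTE; apply: contraNneq xw => e; apply/eqP/val_inj.
Qed.

(** A condition at [C] only involves variables in [A], and one at [D] only variables in [B]. A tuple
    supported on the union is the pair of its restrictions, and the sum factors. *)
Lemma tgfU b A B C D : [disjoint A & B] ->
  (forall u v, v \in C -> desc u v -> u \in A) ->
  (forall u v, v \in D -> desc u v -> u \in B) ->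
  tgf b (A :|: B) (C :|: D) = tgf b A C * tgf b B D.
Proof.
move=> AB CA DB; rewrite !tgf_supp big_distrlr /= pair_big /=.
pose r A (x : {ffun var T -> 'I_b.+1}) : {ffun var T -> 'I_b.+1} :=
  [ffun w => if val w \in A then x w else ord0].
have AF w : val w \in A -> val w \in B = false.
  by move=> wA; rewrite (disjointFr AB wA).
rewrite (reindex_onto (fun z => (r A z, r B z))
  (fun p : {ffun var T -> 'I_b.+1} * {ffun var T -> 'I_b.+1} =>
     [ffun w => if val w \in A then p.1 w else p.2 w])) /=; last first.
  move=> [x y] /= /andP[/andP[/forallP sx _] /andP[/forallP sy _]].
  congr (_, _); apply/ffunP => w; rewrite !ffunE.
    by have := sx w; case: (boolP (val w \in A)) => //= _ /eqP.
  have := sy w; case: (boolP (val w \in B)) => [wB _|_ /= /eqP //].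
  by case: ifP => // /AF; rewrite wB.
have Er (z : {ffun var T -> 'I_b.+1}) :
   ([ffun w => if val w \in A then r A z w else r B z w] == z) = supported (A :|: B) z.
  apply/eqP/forallP => [/ffunP h w|h].
    apply/implyP; rewrite inE negb_or => /andP[wA wB].
    by rewrite -h !ffunE (negPf wA) (negPf wB).
  apply/ffunP => w; rewrite !ffunE; have := h w; rewrite inE.
  by case: (val w \in A) => //=; case: (val w \in B) => //= /eqP ->.
apply: eq_big => [z|z /andP[sz _]].
  rewrite Er andbC; have [sz|] := boolP (supported _ z); rewrite ?andbF ?andbT //.
  have -> : supported A (r A z).
    by apply/forallP => w; apply/implyP => /negPf wA; rewrite ffunE wA.
  have -> : supported B (r B z).
    by apply/forallP => w; apply/implyP => /negPf wA; rewrite ffunE wA.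
  have cA v : v \in C -> condition (fun w => z w) v = condition (fun w => r A z w) v.
    by move=> vC; apply: condition_ext => w wv; rewrite ffunE (CA _ _ vC wv).
  have cB v : v \in D -> condition (fun w => z w) v = condition (fun w => r B z w) v.
    by move=> vC; apply: condition_ext => w wv; rewrite ffunE (DB _ _ vC wv).
  apply/forallP/andP => [h|[/forallP h1 /forallP h2] v].
    split; apply/forallP => v; apply/implyP => vC; rewrite -?cA -?cB //.
      by have := h v; rewrite inE vC.
    by have := h v; rewrite inE vC orbT.
  apply/implyP; rewrite inE => /orP[vC|vD].
    by rewrite cA //; have := h1 v; rewrite vC.
  by rewrite cB //; have := h2 v; rewrite vD.
rewrite -big_split /=; apply: eq_bigr => w _; rewrite /weight !ffunE inE.
case: (boolP (val w \in A)) => [wA|/negPf wA] /=; first by rewrite AF //= mulr1.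
case: (boolP (val w \in B)) => [_|/negPf wB]; first by rewrite mul1r.
have /forallP/(_ w) := sz; rewrite inE wA wB /= => /eqP ->.
by rewrite mulr1.
Qed.

Lemma homog_prod I (r : seq I) (e : I -> int) (f : I -> bps) :
  (forall i, homog (e i) (f i)) -> homog (\sum_(i <- r) e i) (\prod_(i <- r) f i).
Proof.
move=> h; elim: r => [|i r IH]; rewrite ?big_nil ?big_cons.
  by rewrite -kst1; exact: homog_kst.
exact: homogM.
Qed.

Lemma homogX e f n : homog e f -> homog (e * n%:Z) (f ^+ n).
Proof.
move=> h; elim: n => [|n IH]; first by rewrite mulr0 expr0 -kst1; exact: homog_kst.
by rewrite exprS intS mulrDr mulr1; exact: homogM.
Qed.

Lemma sel_homog (B : int -> bool) e f : homog e f -> sel B f = if B e then f else 0.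
Proof.
move=> h; apply: bpsP => N i; rewrite cf_sel.
have [f0|/h ->] := eqVneq (cf f N i) 0; last by case: ifP; rewrite // /cf coef0.
by rewrite f0 if_same; case: ifP; rewrite ?f0 // /cf coef0.
Qed.

Lemma sel_sum (B : int -> bool) I (r : seq I) (Q : pred I) (F : I -> bps) :
  sel B (\sum_(i <- r | Q i) F i) = \sum_(i <- r | Q i) sel B (F i).
Proof.
apply: (big_morph _ (selD B)).
by apply: bpsP => N i; rewrite cf_sel /cf coef0 if_same.
Qed.

Lemma black_white w : is_black (vcolor (val w)) = ~~ is_white (vcolor (val w)).
Proof. by have := valP w; case: (vcolor _). Qed.

(** On the subtree of [v] a tuple contributes a series homogeneous in [u], of degree its white sum
    minus its black sum. The condition at [v] is therefore a selection of [u]-degrees. *)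
Lemma tgf_root b v C :
  tgf b [set u | desc u v] (v |: C) =
  sel (fun k => cmp_holds (vcmp v) k (\sum_(v' | desc v' v) vK v'))
    (tgf b [set u | desc u v] C).
Proof.
rewrite /tgf sel_sum [RHS]big_mkcond [LHS]big_mkcond; apply: eq_bigr => x _.
pose e w : int := if desc (val w) v then
  (if is_white (vcolor (val w)) then (x w)%:Z else - (x w)%:Z) else 0.
rewrite (@sel_homog _ (\sum_w e w)); last first.
  apply: homog_prod => w; rewrite /weight inE /e; case: ifP => _; last first.
    by rewrite -kst_nat; exact: homog_kst.
  rewrite /mon -[X in homog X]add0r; apply: homogM; first exact: homog_kst.
  case: (is_white _); first by rewrite -[X in homog X]mul1r; apply: homogX; exact: homog_bp.
  by rewrite -mulN1r; apply: homogX; exact: homog_bq.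
have -> : cmp_holds (vcmp v) (\sum_w e w) (\sum_(v' | desc v' v) vK v') =
    condition (fun w => x w) v.
  rewrite /condition; congr (cmp_holds _ _ _).
  rewrite [X in X - _]big_mkcond [X in _ - X]big_mkcond -sumrB /=.
  apply: eq_bigr => w _; rewrite /e black_white.
  by case: (desc _ _); case: (is_white _); rewrite /= ?subr0 ?sub0r ?oppr0.
have -> : [forall u in v |: C, condition (fun w => x w) u] =
   condition (fun w => x w) v && [forall u in C, condition (fun w => x w) u].
  apply/forallP/andP => [h|[h1 /forallP h2] u].
    split; first by have := h v; rewrite !inE eqxx.
    by apply/forallP => u; have := h u; rewrite !inE; case: (u \in C); rewrite ?orbT.
  by apply/implyP; rewrite !inE => /orP[/eqP -> //|uC]; have := h2 u; rewrite uC.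
by case: (condition _ v); case: [forall u in C, _].
Qed.

Lemma tgf_free b A : tgf b A set0 = \prod_w \sum_(n < b.+1) weight A w n.
Proof.
rewrite bigA_distr_bigA /tgf; apply: eq_bigl => x.
by apply/forallP => u; rewrite inE.
Qed.

Definition nongray A := [set u in A | ~~ is_gray (vcolor u)].

(* [F b] approximates a series of degree [d] up to order [b]. *)
Definition approximates d (F : nat -> bps) := exists2 f, full_lgen d f &
  forall b N, (N <= b)%N -> pscoef f N = pscoef (F b) N.

Lemma approxM d d' F G : approximates d F -> approximates d' G ->
  approximates (d + d') (fun b => F b * G b).
Proof.
move=> [f hf fF] [g hg gG]; exists (f * g); first exact: lgen_mul.
move=> b N Nb; rewrite !pscoefM; apply: eq_bigr => i _.
rewrite (fF b) ?(gG b) //; first by apply: leq_trans Nb; exact: leq_subr.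
by apply: leq_trans Nb; rewrite -ltnS.
Qed.

Lemma approx_sel d F c (K : int) : approximates d F ->
  approximates d (fun b => sel (fun k => cmp_holds c k K) (F b)).
Proof.
move=> [f hf fF]; exists (sel (fun k => cmp_holds c k K) f); first exact: lgenB_cmp.
move=> b N Nb; apply/polyP => i; have := cf_sel (fun k => cmp_holds c k K) f N i.
by rewrite /cf => ->; have := cf_sel (fun k => cmp_holds c k K) (F b) N i; rewrite /cf => ->; rewrite (fF b).
Qed.

Lemma eq_approx d F G : F =1 G -> approximates d F -> approximates d G.
Proof. by move=> FG [f hf fF]; exists f => // b N Nb; rewrite -FG; exact: fF. Qed.

Lemma approx1 : approximates 0 (fun=> 1).
Proof. by exists 1 => //; apply: lgen_gen; rewrite -kst1; exact: gen_kst. Qed.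

Lemma sum_catalan_approx (c : bool) : approximates 1 (fun b =>
  \sum_(n < b.+1) kst (catalan n) * (if c then bp else bq) ^+ n).
Proof.
exists (embed c catalan_fps); first exact: catalan_lgen.
move=> b N Nb; apply/polyP => i; rewrite -[LHS]/(cf _ N i) -[RHS]/(cf _ N i).
rewrite cf_embed cf_sum.
have E n : cf (kst (catalan n) * (if c then bp else bq) ^+ n) N i =
    if N == n then (if i == (c * N)%N then catalan n else 0) else 0.
  rewrite cf_kstM; case: c; rewrite ?cf_bpX ?cf_bqX ?mul1n ?mul0n;
    case: (N =P n) => [Nn|_] /=; rewrite ?Nn ?mulr0 //; by case: ifP; rewrite ?mulr1 ?mulr0.
under eq_bigr do rewrite E.
rewrite (bigD1 (inord N)) //= inordK // eqxx big1 ?addr0 // => j jN.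
by rewrite ifF //; apply: contraNF jN => /eqP e; apply/eqP/val_inj; rewrite /= inordK.
Qed.

Lemma sum_zero_weight b : \sum_(n < b.+1) (n == 0 :> nat)%:R = 1 :> bps.
Proof. by rewrite big_ord_recl big1 ?addr0. Qed.

(** The factor that a vertex brings apart from its condition: 1 if it is gray, a Catalan series
    otherwise. *)
Lemma leaf_approx v : approximates #|nongray [set v]| (fun b => tgf b [set v] set0).
Proof.
have [gv|ngv] := boolP (is_gray (vcolor v)).
  rewrite (_ : nongray _ = set0) ?cards0; last first.
    by apply/setP => u; rewrite !inE; case: eqP => // ->; rewrite gv.
  apply: eq_approx approx1 => b; rewrite tgf_free big1 // => w _.
  rewrite /weight inE; case: eqP => [wv|_]; last exact: sum_zero_weight.
  by have := valP w; rewrite wv gv.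
rewrite (_ : nongray _ = [set v]) ?cards1; last first.
  by apply/setP => u; rewrite !inE; case: eqP => // ->.
apply: eq_approx (sum_catalan_approx (is_white (vcolor v))) => b.
pose w : var T := exist _ v ngv.
rewrite tgf_free (bigD1 w) //= [X in _ * X]big1 ?mulr1 => [|w' w'w].
  by apply: eq_bigr => n _; rewrite /weight inE eqxx.
rewrite -[RHS](sum_zero_weight b); apply: eq_bigr => n _; rewrite /weight inE ifF //.
by apply: contraNF w'w => /eqP e; apply/eqP/val_inj.
Qed.

(** A down-closed set is a forest, and a vertex [v] of it with the most descendants is the root of a
    component [D]. If [D] is all of [A], removing [v] amounts to undoing a selection and a factor;
    otherwise [A] splits into [D] and its complement. *)
Lemma tgf_approx A : down_closed A -> approximates #|nongray A| (fun b => tgf b A A).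
Proof.
have [m] := ubnP #|A|; elim: m A => // m IH A; rewrite ltnS => Am dA.
have nonU B C : [disjoint B & C] -> #|nongray (B :|: C)| = (#|nongray B| + #|nongray C|)%N.
  move=> BC; rewrite -cardsUI (_ : nongray B :&: nongray C = set0) ?cards0 ?addn0.
    by apply: eq_card => u; rewrite !inE; case: (u \in B); case: (u \in C); rewrite ?orbF ?orbb.
  by apply/setP => u; rewrite !inE; case: (boolP (u \in B)) => // /(disjointFr BC) ->; rewrite andbF.
have [->|[v0 v0A]] := set_0Vmem A.
  rewrite (_ : nongray _ = set0) ?cards0; last by apply/setP => u; rewrite !inE.
  apply: eq_approx approx1 => b; rewrite tgf_free big1 // => w _.
  by rewrite -[RHS](sum_zero_weight b); apply: eq_bigr => n _; rewrite /weight inE.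
have [v /= vA vmax] := arg_maxnP (fun u => #|[set u' | desc u' u]|) v0A.
have {}vA : v \in A by [].
set D := [set u | desc u v]; have DA : D \subset A.
  by apply/subsetP => u; rewrite inE; exact: dA.
have vD : v \in D by rewrite inE desc_refl.
have [AD|nAD] := eqVneq A D.
  have dAv : down_closed (A :\ v).
    move=> u u'; rewrite !inE => /andP[u'v u'A] uu'; rewrite (dA _ _ u'A uu') andbT.
    apply: contraNneq u'v => uv; rewrite uv in uu'; apply/eqP/desc_anti => //.
    by move: u'A; rewrite AD inE.
  have dj : [disjoint A :\ v & [set v]].
    by rewrite disjoint_sym disjoints1 !inE eqxx.
  have EA : A = (A :\ v) :|: [set v] by rewrite setUC setD1K.
  rewrite {1}EA nonU //.
  apply: (@eq_approx _ (fun b => sel (fun k => cmp_holds (vcmp v) k (\sum_(v' | desc v' v) vK v'))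
    (tgf b (A :\ v) (A :\ v) * tgf b [set v] set0))) => [b|].
    rewrite -tgfU //; last by move=> u u'; rewrite in_set0.
    by rewrite setU0 -EA {1 3}AD -tgf_root -/D -AD setD1K.
  apply: approx_sel; apply: approxM; last exact: leaf_approx.
  by apply: IH => //; move: Am; rewrite (cardsD1 v) vA.
(* A vertex below both [v] and [u'] makes them comparable; if [v] is below [u'], maximality gives
   both the same descendants, so that [u'] lies in [D] in either case. *)
have dAD : down_closed (A :\: D).
  move=> u u'; rewrite !inE => /andP[u'D u'A] uu'; rewrite (dA _ _ u'A uu') andbT.
  apply: contra u'D => uv; have /orP[//|vu'] := desc_total uu' uv.
  have sub : D \subset [set u | desc u u'].
    by apply/subsetP => w; rewrite !inE => wv; exact: desc_trans vu'.
  have : u' \in [set u | desc u u'] by rewrite inE desc_refl.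
  have /eqP <- : D == [set u | desc u u'] by rewrite eqEcard sub; exact: vmax.
  by rewrite inE.
have dD : down_closed D.
  by move=> u u'; rewrite !inE => u'v uu'; exact: desc_trans u'v.
have dj : [disjoint D & A :\: D] by rewrite -setI_eq0 setIDA setDIl setDv set0I.
have EA : A = D :|: (A :\: D) by rewrite -{1}(setID A D) (setIidPr DA).
rewrite EA nonU //; apply: (@eq_approx _ (fun b => tgf b D D * tgf b (A :\: D) (A :\: D))).
  by move=> b; rewrite -tgfU.
have pD : D \proper A by rewrite properEneq eq_sym nAD.
apply: approxM; apply: IH => //.
  exact: leq_trans (proper_card pD) Am.
by move: Am; rewrite (cardsD1 v) vA; apply: leq_trans; rewrite ltnS subset_leq_card // setDS // sub1set.
Qed.

Lemma tree_approx : approximates (num_nongray T) (fun b => tgf b setT setT).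
Proof.
rewrite (_ : num_nongray T = #|nongray setT|); first exact: tgf_approx.
by apply: eq_card => v; rewrite !inE.
Qed.
End Tree.

(** * Specialization to one variable *)

(** The root's condition is already imposed, so selecting the degree [K] once more changes nothing;
    but the selected series is a single coefficient in [u], which lies in the base algebra. *)
Lemma tree_approx_eq T : vcmp (troot T) = CmpEq ->
  exists2 f, base_lgen (num_nongray T) f &
    forall b N, (N <= b)%N -> pscoef f N = pscoef (@tgf T b setT setT) N.
Proof.
move=> rE; have [f hf fF] := tree_approx T; pose K : int := \sum_(v' | desc v' (troot T)) vK v'.
have [_ _ hd] := lgenB_good hf; exists (diag K f) => // b N Nb.
have rF : @tgf T b setT setT = diag K (@tgf T b setT setT).
  have EA : [set u | desc u (troot T)] = setT.
    by apply/setP => u; rewrite !inE; exact: parent_connect.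
  have ET : troot T |: setT = setT by apply/setP => u; rewrite !inE orbT.
  by have := tgf_root b (troot T) setT; rewrite EA ET rE.
rewrite rF; apply/polyP => i; rewrite -[LHS]/(cf _ N i) -[RHS]/(cf _ N i).
by rewrite !cf_sel /cf (fF b).
Qed.

(* Setting [p = q = t], i.e. [u = 1]. *)
Definition ev (f : bps) : fps := Fps (fun N => (pscoef f N).[1]).

Lemma evD f g : ev (f + g) = ev f + ev g.
Proof. by apply/fpsP => N /=; rewrite hornerD. Qed.

Lemma evM f g : ev (f * g) = ev f * ev g.
Proof.
apply/fpsP => N; rewrite -[LHS]/((pscoef (f * g) N).[1]) pscoefM horner_sum.
by apply: eq_bigr => i _; rewrite hornerM.
Qed.

Lemma fps_of_polyD p q : fps_of_poly (p + q) = fps_of_poly p + fps_of_poly q.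
Proof. by apply/fpsP => N /=; rewrite coefD. Qed.

Lemma fps_of_polyM p q : fps_of_poly (p * q) = fps_of_poly p * fps_of_poly q.
Proof. by apply/fpsP => N; rewrite [LHS]/= coefM. Qed.

Lemma fps_of_poly1 : fps_of_poly 1 = 1.
Proof. by apply/fpsP => N /=; rewrite coef1. Qed.

Lemma fps_of_polyX p n : fps_of_poly (p ^+ n) = fps_of_poly p ^+ n.
Proof.
by elim: n => [|n IH]; rewrite ?expr0 ?fps_of_poly1 // !exprS fps_of_polyM IH.
Qed.

Lemma ev_kst c : ev (kst c) = fps_of_poly c%:P.
Proof. by apply/fpsP => -[|N] /=; rewrite ?hornerC ?horner0 coefC. Qed.
Lemma ev1 : ev 1 = 1. Proof. by rewrite -kst1 ev_kst fps_of_poly1. Qed.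
Lemma ev_bp : ev bp = fps_of_poly 'X.
Proof. by apply/fpsP => -[|[|N]] /=; rewrite ?hornerX ?horner0 coefX. Qed.
Lemma ev_bq : ev bq = fps_of_poly 'X.
Proof. by apply/fpsP => -[|[|N]] /=; rewrite ?hornerC ?horner0 coefX. Qed.

Lemma ev_diag f : (forall n, odd n -> coef f n = 0) -> ev (lift_diag f) = f.
Proof.
move=> f0; apply/fpsP => N /=; case: ifP => [/f0 ->|_]; first by rewrite horner0.
by rewrite hornerZ hornerXn expr1n mulr1.
Qed.

Lemma ev_h1 : ev h1 = H1. Proof. by apply: ev_diag => n /= ->. Qed.
Lemma ev_h2 : ev h2 = H2. Proof. by apply: ev_diag => n /= ->. Qed.

Lemma ev_embed c f : ev (embed c f) = f.
Proof. by apply/fpsP => N /=; rewrite hornerZ hornerXn expr1n mulr1. Qed.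

(* [P] is symmetric in [p] and [q]. *)
Lemma ev_bW_bWn : ev bW = ev bWn.
Proof.
have E (f : bps) N m : (size (pscoef f N) <= m)%N ->
    coef (ev f) N = \sum_(i < m) cf f N i.
  move=> sm /=; rewrite (horner_coef_wide _ sm); apply: eq_bigr => i _.
  by rewrite expr1n mulr1.
apply/fpsP => N.
have sz B : (size (pscoef (sel B bP) N) <= N.+1)%N.
  apply/leq_sizeP => i Ni; rewrite -[_`_i]/(cf (sel B bP) N i) cf_sel cf_bP.
  by rewrite leqNgt Ni if_same.
rewrite !(E _ _ _ (sz _)) [RHS](reindex_inj rev_ord_inj) /=.
apply: eq_bigr => i _; rewrite !cf_sel !cf_bP subSS leq_subr -ltnS ltn_ord.
rewrite subKn ?leq_ord // mulrC.
have -> // : (0 <= udeg N i) = (udeg N (N - i) <= 0).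
have := ltn_ord i; rewrite /udeg; lia.
Qed.

Lemma ev_bW : ev bW = fps_of_poly (2%:R^-1 *: (1 - 4%:R *: 'X)) + fps_of_poly 2%:R^-1%:P * H1.
Proof.
have E : ev bW + ev bW = fps_of_poly (1 - 4%:R *: 'X) + H1.
  by rewrite {2}ev_bW_bWn -evD bW_sum evD evM !ev_embed ev_h1 -expr2 sqrt_1m4t_sqr.
have half (f : fps) : fps_of_poly 2%:R^-1%:P * (f + f) = f.
  rewrite mulrDr -mulrDl -fps_of_polyD -polyCD (_ : _ + _ = 1) //.
  by rewrite polyC1 fps_of_poly1 mul1r.
by rewrite -[LHS]half E mulrDr -fps_of_polyM mul_polyC.
Qed.

(** * Generation in one variable *)

(** The flag admits the square root. Only polynomials in [t] are coefficients here: inverse powers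
    of [t] enter when the series are read as Laurent series. *)
Inductive fgen (withs : bool) : nat -> fps -> Prop :=
| fgen_poly p : fgen withs 0 (fps_of_poly p)
| fgen_H1 : fgen withs 2 H1
| fgen_H2 : fgen withs 2 H2
| fgen_sqrt : withs -> fgen withs 1 sqrt_1m4t
| fgen_add d f g : fgen withs d f -> fgen withs d g -> fgen withs d (f + g)
| fgen_mul d e f g : fgen withs d f -> fgen withs e g -> fgen withs (d + e) (f * g)
| fgen_le d e f : (d <= e)%N -> fgen withs d f -> fgen withs e f.

Lemma gen_ev (E : nat -> bps -> Prop) withs d f :
  (forall d g, E d g -> fgen withs d (ev g)) -> gen E d f -> fgen withs d (ev f).
Proof.
move=> hE; elim=> {d f} [c|||||d f /hE //|d f g _ hf _ hg|d e f g _ hf _ hg|d e f de _ hf].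
- by rewrite ev_kst; constructor.
- by rewrite ev_bp; constructor.
- by rewrite ev_bq; constructor.
- by rewrite ev_h1; constructor.
- by rewrite ev_h2; constructor.
- by rewrite evD; exact: fgen_add.
- by rewrite evM; exact: fgen_mul.
by apply: fgen_le hf.
Qed.

Lemma fgen_ev_bW withs : fgen withs 2 (ev bW).
Proof.
rewrite ev_bW; apply: fgen_add; first by apply: (@fgen_le _ 0) => //; constructor.
by apply: (@fgen_mul _ 0 2); constructor.
Qed.

Lemma lgen_ev (E : nat -> bps -> Prop) withs d f :
  (forall d g, E d g -> fgen withs d (ev g)) -> lgen E d f ->
  exists M, fgen withs d (fps_of_poly 'X ^+ M * ev f).
Proof.
move=> hE [N h]; exists (N + N)%N; have := gen_ev hE h.
suff -> : ev ((bp * bq) ^+ N * f) = fps_of_poly 'X ^+ (N + N) * ev f by [].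
rewrite evM; congr (_ * _); elim: N {h} => [|N IH]; first by rewrite !expr0 ev1.
by rewrite exprS !evM ev_bp ev_bq IH addSn addnS !exprS mulrA.
Qed.

(** With [b = N] both sides run over the same tuples; at [u = 1] a tuple contributes a multiple of
    [t] to the power its sum, so that those of sum [N] remain. *)
Lemma ev_tree T (f : bps) :
  (forall b N, (N <= b)%N -> pscoef f N = pscoef (@tgf T b setT setT) N) ->
  ev f = tree_series T.
Proof.
move=> h; apply/fpsP => N; rewrite -[LHS]/((pscoef f N).[1]) (h N N) // -[LHS]/(coef (ev _) N).
have ev_sum I (r : seq I) (Q : pred I) (F : I -> bps) :
    coef (ev (\sum_(i <- r | Q i) F i)) N = \sum_(i <- r | Q i) coef (ev (F i)) N.
  by rewrite /= pscoef_sum horner_sum.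
rewrite /tgf ev_sum [RHS]/= big_mkcond [RHS]big_mkcond; apply: eq_bigr => x _.
have -> : [forall v in [set: vertex T], condition (fun w => x w) v] =
    [forall v, condition (fun w => x w) v].
  by apply: eq_forallb => v; rewrite inE.
case: (boolP [forall v, _]) => _; last by rewrite andbF.
rewrite andbT.
have -> : ev (\prod_w weight setT w (x w)) =
    fps_of_poly ((\prod_w catalan (x w))%:P * 'X ^+ (\sum_w x w)).
  rewrite (big_morph ev evM ev1) rmorph_prod /= -prodrXr -big_split /=.
  rewrite (big_morph fps_of_poly fps_of_polyM fps_of_poly1); apply: eq_bigr => w _.
  rewrite /weight inE evM ev_kst fps_of_polyM fps_of_polyX; congr (_ * _).
  elim: (x w : nat) => [|n IH]; first by rewrite !expr0 ev1.
  by rewrite !exprS evM IH /mon; case: ifP; rewrite ?ev_bp ?ev_bq.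
rewrite [LHS]/= coefCM coefXn eq_sym; case: eqP => _; rewrite ?mulr1 ?mulr0 //.
Qed.

(** * Polynomial expressions in [H1], [H2] and the square root *)

Module Expressions.
Import mpoly.

Lemma laurent_polyD x y : is_laurent_poly x -> is_laurent_poly y -> is_laurent_poly (x + y).
Proof.
move=> [p [k ->]] [q [l ->]]; exists (p * 'X ^+ l + q * 'X ^+ k), (k + l)%N.
have t0 : to_laurent (fps_of_poly 'X) != 0.
  rewrite tofrac_eq0; apply/eqP => /fpsP /(_ 1%N) /=; rewrite coefX /=.
  by move/eqP; rewrite oner_eq0.
rewrite fps_of_polyD !fps_of_polyM !fps_of_polyX rmorphD !rmorphM !rmorphXn /= exprD.
by rewrite addf_div ?expf_neq0.
Qed.

Lemma laurent_polyM x y : is_laurent_poly x -> is_laurent_poly y -> is_laurent_poly (x * y).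
Proof.
move=> [p [k ->]] [q [l ->]]; exists (p * q), (k + l)%N.
by rewrite fps_of_polyM rmorphM /= exprD invfM mulrACA.
Qed.

Lemma laurent_poly_poly p : is_laurent_poly (to_laurent (fps_of_poly p)).
Proof. by exists p, 0%N; rewrite expr0 divr1. Qed.

Lemma laurent_poly_tV k : is_laurent_poly (to_laurent (fps_of_poly 'X) ^+ k)^-1.
Proof. by exists 1, k; rewrite fps_of_poly1 rmorph1 div1r. Qed.

Lemma laurent_poly0 : is_laurent_poly 0.
Proof.
exists 0, 0%N; rewrite (_ : fps_of_poly 0 = 0) ?rmorph0 ?mul0r //.
by apply/fpsP => N /=; rewrite coef0.
Qed.

Lemma laurent_poly1 : is_laurent_poly 1.
Proof. by rewrite -[1](rmorph1 (to_laurent)) -fps_of_poly1; exact: laurent_poly_poly. Qed.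

Lemma laurent_poly_sum I (r : seq I) (Q : pred I) (F : I -> laurent) :
  (forall i, is_laurent_poly (F i)) -> is_laurent_poly (\sum_(i <- r | Q i) F i).
Proof.
move=> h; elim/big_rec: _ => [|i x _ hx]; first exact: laurent_poly0.
exact: laurent_polyD.
Qed.

Lemma coefs_add n (P Q : {mpoly laurent[n]}) :
  laurent_poly_coefs P -> laurent_poly_coefs Q -> laurent_poly_coefs (P + Q).
Proof. by move=> hP hQ m; rewrite mcoeffD; apply: laurent_polyD. Qed.

Lemma coefs_mul n (P Q : {mpoly laurent[n]}) :
  laurent_poly_coefs P -> laurent_poly_coefs Q -> laurent_poly_coefs (P * Q).
Proof.
by move=> hP hQ m; rewrite mcoeffM; apply: laurent_poly_sum => k; apply: laurent_polyM.
Qed.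

Lemma coefs_C n c : is_laurent_poly c -> laurent_poly_coefs (c%:MP : {mpoly laurent[n]}).
Proof.
move=> hc m; rewrite mcoeffC; case: eqP => _; rewrite ?mulr1 ?mulr0 //.
exact: laurent_poly0.
Qed.

Lemma coefs_X n (i : 'I_n) : laurent_poly_coefs ('X_i : {mpoly laurent[n]}).
Proof.
move=> m; rewrite mcoeffX; case: eqP => _; [exact: laurent_poly1|exact: laurent_poly0].
Qed.

(** An upper bound on the degree, which unlike the exact minimum passes to sums and products. *)
Definition exprB d x := exists P, expresses P x /\ (wdeg P <= d)%N.

Lemma wdeg_le (P : {mpoly laurent[3]}) d :
  (forall m, m \in msupp P -> (\sum_(i < 3) m i * genB_weight i <= d)%N) ->
  (wdeg P <= d)%N.
Proof. by move=> h; apply/bigmax_leqP_seq => m mP _; exact: h. Qed.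

Lemma wdeg_ge (P : {mpoly laurent[3]}) (m : 'X_{1..3}) : m \in msupp P ->
  (\sum_(i < 3) m i * genB_weight i <= wdeg P)%N.
Proof. by move=> mP; apply: (leq_bigmax_seq (F := fun m : 'X_{1..3} => (\sum_(i < 3) m i * genB_weight i)%N)). Qed.

Lemma exprB_add d x y : exprB d x -> exprB d y -> exprB d (x + y).
Proof.
move=> [P [[P1 ->] P2]] [Q [[Q1 ->] Q2]]; exists (P + Q); split.
  by split; [exact: coefs_add|rewrite mevalD].
apply: wdeg_le => m /msuppD_le; rewrite mem_cat => /orP[] /wdeg_ge h.
  exact: leq_trans P2.
exact: leq_trans Q2.
Qed.

Lemma exprB_mul d e x y : exprB d x -> exprB e y -> exprB (d + e) (x * y).
Proof.
move=> [P [[P1 ->] P2]] [Q [[Q1 ->] Q2]]; exists (P * Q); split.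
  by split; [exact: coefs_mul|rewrite mevalM].
apply: wdeg_le => m /msuppM_le /allpairsP[[a b] /= [/wdeg_ge ha /wdeg_ge hb ->]].
under eq_bigr do rewrite mnmDE mulnDl.
rewrite big_split /=; apply: leq_add; [exact: leq_trans P2|exact: leq_trans Q2].
Qed.

Lemma exprB_C c : is_laurent_poly c -> exprB 0 c.
Proof.
move=> hc; exists c%:MP; split; first by split; [exact: coefs_C|rewrite mevalC].
apply: wdeg_le => m; rewrite msuppC; case: eqP => // _; rewrite inE => /eqP ->.
by rewrite big1 // => i _; rewrite mnm0E.
Qed.

Lemma exprB_X (i : 'I_3) : exprB (genB_weight i) (genB i).
Proof.
exists 'X_i; split; first by split; [exact: coefs_X|rewrite mevalXU].
apply: wdeg_le => m; rewrite msuppX inE => /eqP ->.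
rewrite (bigD1 i) //= mnm1E eqxx mul1n big1 ?addn0 // => j ji.
by rewrite mnm1E eq_sym (negPf ji).
Qed.

Lemma fgen_exprB d f : fgen true d f -> exprB d (to_laurent f).
Proof.
elim=> {d f} [p||||d f g _ hf _ hg|d e f g _ hf _ hg|d e f de _ [P [h1 h2]]].
- by apply: exprB_C; exact: laurent_poly_poly.
- exact: (exprB_X 0).
- exact: (exprB_X 1).
- by move=> _; exact: (exprB_X 2).
- by rewrite rmorphD; exact: exprB_add.
- by rewrite rmorphM; exact: exprB_mul.
by exists P; split=> //; exact: leq_trans de.
Qed.

Lemma in_AD x y : in_A x -> in_A y -> in_A (x + y).
Proof.
by move=> [P [hP ->]] [Q [hQ ->]]; exists (P + Q); rewrite mevalD; split=> //; exact: coefs_add.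
Qed.

Lemma in_AM x y : in_A x -> in_A y -> in_A (x * y).
Proof.
by move=> [P [hP ->]] [Q [hQ ->]]; exists (P * Q); rewrite mevalM; split=> //; exact: coefs_mul.
Qed.

Lemma in_A_laurent x : is_laurent_poly x -> in_A x.
Proof. by move=> hx; exists x%:MP; rewrite mevalC; split=> //; exact: coefs_C. Qed.

Lemma in_A_gen (i : 'I_2) : in_A (genA i).
Proof. by exists 'X_i; rewrite mevalXU; split=> //; exact: coefs_X. Qed.

Lemma fgen_in_A d f : fgen false d f -> in_A (to_laurent f).
Proof.
elim=> {d f} [p||| //|d f g _ hf _ hg|d e f g _ hf _ hg|//].
- by apply: in_A_laurent; exact: laurent_poly_poly.
- exact: (in_A_gen 0).
- exact: (in_A_gen 1).
- by rewrite rmorphD; exact: in_AD.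
by rewrite rmorphM; exact: in_AM.
Qed.

Lemma in_A0 : in_A 0. Proof. by apply: in_A_laurent; exact: laurent_poly0. Qed.

Lemma in_BD x y : in_B x -> in_B y -> in_B (x + y).
Proof.
move=> [p [hp ->]] [q [hq ->]]; exists (p + q); rewrite hornerD; split=> // i.
by rewrite coefD; exact: in_AD.
Qed.

Lemma in_BM x y : in_B x -> in_B y -> in_B (x * y).
Proof.
move=> [p [hp ->]] [q [hq ->]]; exists (p * q); rewrite hornerM; split=> // i.
rewrite coefM; elim/big_rec: _ => [|j z _ hz]; first exact: in_A0.
by apply: in_AD => //; exact: in_AM.
Qed.

Lemma in_AB x : in_A x -> in_B x.
Proof.
move=> hx; exists x%:P; rewrite hornerC; split=> // i; rewrite coefC.
by case: ifP => // _; exact: in_A0.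
Qed.

Lemma in_B_sqrt : in_B (to_laurent sqrt_1m4t).
Proof.
exists 'X; rewrite hornerX; split=> // i; rewrite coefX; case: (i == 1%N).
  by apply: in_A_laurent; exact: laurent_poly1.
exact: in_A0.
Qed.

Lemma fgen_in_B d f : fgen true d f -> in_B (to_laurent f).
Proof.
elim=> {d f} [p|||_|d f g _ hf _ hg|d e f g _ hf _ hg|//].
- by apply/in_AB/in_A_laurent; exact: laurent_poly_poly.
- exact: (in_AB (in_A_gen 0)).
- exact: (in_AB (in_A_gen 1)).
- exact: in_B_sqrt.
- by rewrite rmorphD; exact: in_BD.
by rewrite rmorphM; exact: in_BM.
Qed.

Lemma laurent_divt M (f : fps) : to_laurent f =
  (to_laurent (fps_of_poly 'X) ^+ M)^-1 * to_laurent (fps_of_poly 'X ^+ M * f).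
Proof.
have t0 : to_laurent (fps_of_poly 'X) != 0.
  rewrite tofrac_eq0; apply/eqP => /fpsP /(_ 1%N) /=; rewrite coefX /=.
  by move/eqP; rewrite oner_eq0.
rewrite tofracM tofracXn; apply/esym/mulKf; exact: expf_neq0.
Qed.

Lemma has_degB_le d x : exprB d x -> exists e, has_degB x e /\ (e <= d)%N.
Proof.
move=> [P0 [h0 hd]].
have ex : exists e, `[< exists P, expresses P x /\ wdeg P = e >].
  by exists (wdeg P0); apply/asboolP; exists P0.
case: (ex_minnP ex) => e /asboolP he min; exists e; split; last first.
  by apply: leq_trans hd; apply: min; apply/asboolP; exists P0.
by split=> // P hP; apply: min; apply/asboolP; exists P.
Qed.
End Expressions.

(** * Membership and degree of the tree series *)

Lemma tree_fgen T : exists M, fgen true (num_nongray T) (fps_of_poly 'X ^+ M * tree_series T).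
Proof.
have [f hf /ev_tree <-] := tree_approx T; apply: lgen_ev hf => d g [].
- by rewrite ev_embed; constructor.
- by rewrite ev_embed; constructor.
- exact: fgen_ev_bW.
by rewrite -ev_bW_bWn; exact: fgen_ev_bW.
Qed.

Lemma tree_fgen_eq T : vcmp (troot T) = CmpEq ->
  exists M, fgen false (num_nongray T) (fps_of_poly 'X ^+ M * tree_series T).
Proof.
by move=> /tree_approx_eq[f hf /ev_tree <-]; apply: lgen_ev hf => d g [].
Qed.

Lemma tree_in_B T : in_B (to_laurent (tree_series T)).
Proof.
have [M hM] := tree_fgen T; rewrite (Expressions.laurent_divt M).
apply: Expressions.in_BM; last exact: Expressions.fgen_in_B hM.
by apply/Expressions.in_AB/Expressions.in_A_laurent; exact: Expressions.laurent_poly_tV.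
Qed.

Lemma tree_in_A T : vcmp (troot T) = CmpEq -> in_A (to_laurent (tree_series T)).
Proof.
move=> /tree_fgen_eq[M hM]; rewrite (Expressions.laurent_divt M).
apply: Expressions.in_AM; last exact: Expressions.fgen_in_A hM.
by apply: Expressions.in_A_laurent; exact: Expressions.laurent_poly_tV.
Qed.

Lemma tree_degB T : exists d,
  has_degB (to_laurent (tree_series T)) d /\ (d <= num_nongray T)%N.
Proof.
have [M hM] := tree_fgen T; apply: Expressions.has_degB_le; rewrite (Expressions.laurent_divt M).
apply: (@Expressions.exprB_mul 0); last exact: Expressions.fgen_exprB hM.
by apply: Expressions.exprB_C; exact: Expressions.laurent_poly_tV.
Qed.

From mathcomp Require Import all_classical all_reals all_analysis.
Import numFieldNormedType.Exports.
Local Open Scope classical_set_scope.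
Local Open Scope ring_scope.

(** * Values at 1/4 *)

Section Wallis.
Variable R : realType.

(* The primitive of [sin ^+ n] vanishing at 0. *)
Fixpoint sin_prim (n : nat) (x : R) : R :=
  match n with
  | 0 => x
  | 1 => 1 - cos x
  | (m.+1 as n').+1 => (n'%:R * sin_prim m x - cos x * sin x ^+ n') / n'.+1%:R
  end.

(** The recursion is the reduction formula obtained by integrating by parts; its derivative closes
    up through [cos^2 = 1 - sin^2]. It has step two, hence the induction on consecutive pairs. *)
Lemma is_derive_sin_prim n (x : R) : is_derive x 1 (sin_prim n) (sin x ^+ n).
Proof.
suff [] : is_derive x 1 (sin_prim n) (sin x ^+ n) /\
  is_derive x 1 (sin_prim n.+1) (sin x ^+ n.+1) by [].
elim: n => [|n [IH1 IH2]].
  split; first by rewrite expr0; exact: is_derive_id.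
  rewrite expr1; have -> : sin_prim 1 = cst 1 - cos by [].
  by apply: is_derive_eq; rewrite sub0r opprK.
split=> //.
have -> : sin_prim n.+2 = n.+2%:R^-1 *: (n.+1%:R *: sin_prim n - cos * sin ^+ n.+1).
  by apply/funext => y; rewrite /= mulrC; congr (_ * (_ - _ * _)); rewrite fctE.
apply: is_derive_eq.
have e : cos x * cos x = 1 - sin x ^+ 2 by rewrite -(cos2Dsin2 x) addrK expr2.
have n0 : n.+2%:R != 0 :> R by rewrite pnatr_eq0.
have -> : (sin ^+ n.+1) x = sin x ^+ n.+1 by elim: (n.+1) => // m IHm; rewrite !exprS -IHm.
rewrite /GRing.scale /= mulrCA mulrCA (mulrC _ (cos x)) (mulrA (cos x)) e.
apply: (mulfI n0); rewrite mulrA divff // mul1r !exprS -[in RHS]natr1; ring.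
Qed.

Lemma sin_prim0 n : sin_prim n 0 = 0.
Proof.
suff [] : sin_prim n 0 = 0 /\ sin_prim n.+1 0 = 0 by [].
elim: n => [|n [IH1 IH2]]; first by rewrite /= cos0 subrr.
split=> //; rewrite [LHS]/= -/(sin_prim n 0) IH1 sin0 exprS mul0r !mulr0 subrr mul0r //.
Qed.

(** The integral of [sin^n] over [[0, pi/2]], as the value of a primitive. *)
Definition wallis n := sin_prim n (pi / 2%:R).

Lemma wallisSS n : wallis n.+2 = n.+1%:R / n.+2%:R * wallis n.
Proof.
rewrite /wallis [LHS]/= -/(sin_prim n _) cos_pihalf mul0r subr0; ring.
Qed.

Lemma wallis_decr n : wallis n.+1 <= wallis n.
Proof.
have p0 : 0 < pi / 2 :> R by rewrite divr_gt0 ?pi_gt0.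
have d (x : R) : is_derive x 1 (sin_prim n - sin_prim n.+1) (sin x ^+ n - sin x ^+ n.+1).
  by apply: is_deriveB; exact: is_derive_sin_prim.
have [|c cI] := MVT_segment (ltW p0) (fun x _ => d x).
  apply: continuous_subspaceT => x; apply: differentiable_continuous.
  by apply/derivable1_diffP; apply: ex_derive.
rewrite !fctE !sin_prim0 subrr !subr0 -subr_ge0 => ->.
rewrite mulr_ge0 ?(ltW p0) // exprS -{1}[sin c ^+ n]mul1r -mulrBl mulr_ge0 //.
apply: exprn_ge0; apply: sin_ge0_pi; move: cI; rewrite in_itv /= => /andP[-> c2].
by apply: (le_trans c2); have := pi_gt0 R; lra.
Qed.

Lemma wallis0 : wallis 0 = pi / 2%:R. Proof. by []. Qed.
Lemma wallis1 : wallis 1 = 1.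
Proof. by rewrite /wallis /= cos_pihalf subr0. Qed.

Lemma wallis_gt0 n : 0 < wallis n.
Proof.
suff [] : 0 < wallis n /\ 0 < wallis n.+1 by [].
elim: n => [|n [IH1 IH2]].
  by rewrite wallis1 wallis0 divr_gt0 ?pi_gt0.
by split=> //; rewrite wallisSS mulr_gt0 // divr_gt0.
Qed.

(** The factors are the ratios of [gauss i] to [gauss i.+1] in [gauss_rec], and also govern the
    quotients of consecutive Wallis integrals, by [wallis_prodE]. *)
Definition wallis_prod k : R :=
  \prod_(i < k) ((i%:R + 3%:R / 2%:R) ^+ 2 / (i.+1%:R * i.+2%:R)).

Lemma wallis_prodE k :
  wallis (2 * k).+2 = pi / 4%:R * wallis_prod k * wallis (2 * k).+1.
Proof.
elim: k => [|k IH].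
  by rewrite muln0 wallisSS wallis0 wallis1 /wallis_prod big_ord0; field.
rewrite mulnS !add2n wallisSS (wallisSS (2 * k).+1) IH /wallis_prod big_ord_recr /=.
rewrite -/(wallis_prod k) -!natr1 natrM.
have k0 : 0 <= k%:R :> R by [].
by field; rewrite -!(rwP andP); do !split; apply: lt0r_neq0; lra.
Qed.

(** The middle term is the quotient of the integrals of index [2k + 2] and [2k + 1]; by monotonicity
    it lies between the quotient for [2k + 3] and [2k + 1] and 1. *)
Lemma wallis_bounds k :
  (2 * k).+2%:R / (2 * k).+3%:R <= pi / 4%:R * wallis_prod k <= 1.
Proof.
have w0 := wallis_gt0 (2 * k).+1; apply/andP; split; rewrite -(ler_pM2r w0).
  by rewrite -wallis_prodE -wallisSS; exact: wallis_decr.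
by rewrite -wallis_prodE mul1r; exact: wallis_decr.
Qed.
End Wallis.

(** * Absolutely convergent sums and Cauchy products *)

Section Values.
Variable R : realType.
Implicit Types (u v : nat -> R).

Definition psum u n : R := \sum_(k < n) u k.
Definition conv u v n : R := \sum_(i < n.+1) u i * v (n - i)%N.

Lemma psumS u n : psum u n.+1 = psum u n + u n.
Proof. exact: big_ord_recr. Qed.

Lemma psum_conv u v n : psum (conv u v) n = \sum_(i < n) u i * psum v (n - i).
Proof.
elim: n => [|n IH]; first by rewrite /psum !big_ord0.
rewrite psumS IH.
have -> : \sum_(i < n) u i * psum v (n - i) = \sum_(i < n.+1) u i * psum v (n - i).
  by rewrite [RHS]big_ord_recr /= subnn /psum big_ord0 mulr0 addr0.
rewrite -big_split /=; apply: eq_bigr => i _.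
by rewrite -mulrDr -psumS subSn // -ltnS.
Qed.

Lemma psum_le u m n : (forall k, 0 <= u k) -> (m <= n)%N -> psum u m <= psum u n.
Proof.
move=> u0 /subnKC <-; elim: (n - m)%N => [|k IH]; first by rewrite addn0.
by rewrite addnS psumS (le_trans IH) // lerDl.
Qed.

Lemma psum_diff u m n : (m <= n)%N ->
  `|psum u n - psum u m| <= psum (fun k => `|u k|) n - psum (fun k => `|u k|) m.
Proof.
move=> /subnKC <-; elim: (n - m)%N => [|k IH]; first by rewrite addn0 !subrr normr0.
rewrite addnS !psumS addrAC [leRHS]addrAC (le_trans (ler_normD _ _)) //.
by rewrite lerD2r.
Qed.

Definition abs_sums u (a : R) :=
  (exists M, forall n, psum (fun k => `|u k|) n <= M) /\ psum u @ \oo --> a.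

Lemma psum_cvg u M : (forall k, 0 <= u k) -> (forall n, psum u n <= M) ->
  exists l, psum u @ \oo --> l /\ forall n, psum u n <= l.
Proof.
move=> u0 uM; have nd : nondecreasing_seq (psum u) by move=> m n; exact: psum_le.
have cu : cvgn (psum u).
  by apply: nondecreasing_is_cvgn => //; exists M => _ [n _ <-].
exists (limn (psum u)); split=> // n; exact: nondecreasing_cvgn_le.
Qed.

(** The triangular sum differs from the product of the partial sums by at most the same difference
    for absolute values, which tends to 0. *)
Lemma abs_sumsM u v a b : abs_sums u a -> abs_sums v b -> abs_sums (conv u v) (a * b).
Proof.
move=> [[M uM] ua] [[L vL] vb].
pose p k := `|u k|; pose q k := `|v k|.
have p0 k : 0 <= p k by exact: normr_ge0.
have q0 k : 0 <= q k by exact: normr_ge0.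
have c0 k : 0 <= conv p q k by apply: sumr_ge0 => i _; rewrite mulr_ge0.
have [P [pP Pge]] := psum_cvg p0 uM; have [Q [qQ Qge]] := psum_cvg q0 vL.
have CPQ n : psum (conv p q) n <= psum p n * psum q n.
  rewrite psum_conv {2}/psum mulr_suml; apply: ler_sum => i _.
  by rewrite ler_wpM2l // psum_le // leq_subr.
have P0 : 0 <= P by apply: le_trans (Pge 0%N); rewrite /psum big_ord0.
have CM n : psum (conv p q) n <= P * Q.
  apply: (le_trans (CPQ n)); apply: ler_pM => //; exact: sumr_ge0.
(* The square of side [n] is contained in the triangle of side [2n]; together with [CPQ] this
   identifies the limit of the triangular sums. *)
have PQC n : psum p n * psum q n <= psum (conv p q) (n + n).
  rewrite psum_conv big_split_ord /= {1}/psum mulr_suml -[leLHS]addr0.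
  apply: lerD; last by apply: sumr_ge0 => i _; rewrite mulr_ge0 ?sumr_ge0.
  by apply: ler_sum => i _; rewrite ler_wpM2l // psum_le // -addnBA ?leq_addr // ltnW.
have [C [cC Cge]] := psum_cvg c0 CM.
have EC : C = P * Q.
  apply/eqP; rewrite eq_le; apply/andP; split.
    by apply: (cvgr_to_le cC); near=> n; exact: CM.
  apply: (cvgr_to_le (cvgM pP qQ)); near=> n; exact: le_trans (PQC n) (Cge _).
split.
  exists (P * Q) => n; apply: le_trans (CM n); apply: ler_sum => i _.
  by apply: (le_trans (ler_norm_sum _ _ _)); apply: ler_sum => j _; rewrite normrM.
have key n : `|psum u n * psum v n - psum (conv u v) n| <=
    psum p n * psum q n - psum (conv p q) n.
  rewrite !psum_conv {1 5}/psum !mulr_suml -!sumrB.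
  apply: (le_trans (ler_norm_sum _ _ _)); apply: ler_sum => i _.
  by rewrite -!mulrBr normrM ler_wpM2l // psum_diff // leq_subr.
have z : (fun n => psum p n * psum q n - psum (conv p q) n) @ \oo --> (0 : R).
  by rewrite -(subrr (P * Q)) -{2}EC; apply: cvgB => //; exact: cvgM.
have z' : (fun n => psum u n * psum v n - psum (conv u v) n) @ \oo --> (0 : R).
  by apply: norm_cvg0; apply: squeeze_cvgr (cvg_cst 0) z; near=> n; rewrite normr_ge0 key.
have -> : psum (conv u v) = (fun n => psum u n * psum v n -
   (psum u n * psum v n - psum (conv u v) n)).
  by apply/funext => n; rewrite subKr.
by rewrite -[a * b]subr0; apply: cvgB => //; exact: cvgM.
Unshelve. all: by end_near.
Qed.

Lemma abs_sumsD u v a b : abs_sums u a -> abs_sums v b -> abs_sums (fun n => u n + v n) (a + b).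
Proof.
move=> [[M uM] ua] [[L vL] vb]; split.
  exists (M + L) => n; apply: le_trans (lerD (uM n) (vL n)).
  rewrite /psum -big_split /=; apply: ler_sum => i _; exact: ler_normD.
have -> : psum (fun n => u n + v n) = (fun n => psum u n + psum v n).
  by apply/funext => n; rewrite /psum big_split.
exact: cvgD.
Qed.

Lemma abs_sums_fin u N : (forall n, (N <= n)%N -> u n = 0) -> abs_sums u (psum u N).
Proof.
move=> u0; have E v : (forall n, (N <= n)%N -> v n = 0) ->
    forall n, (N <= n)%N -> psum v n = psum v N.
  move=> v0 n /subnKC <-; elim: (n - N)%N => [|k IH]; first by rewrite addn0.
  by rewrite addnS psumS IH v0 ?addr0 ?leq_addr.
split.
  exists (psum (fun k => `|u k|) N) => n; have [nN|/ltnW Nn] := leqP n N.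
    by apply: psum_le.
  by rewrite (E (fun k => `|u k|)) // => m /u0 ->; rewrite normr0.
apply: cvg_near_cst; near=> n; apply: E => //; near: n; exact: nbhs_infty_ge.
Unshelve. all: by end_near.
Qed.

Lemma psum_even u : (forall n, odd n -> u n = 0) ->
  psum u = fun n => psum (fun j => u j.*2) (uphalf n).
Proof.
move=> u0; apply/funext; elim=> [|n IH]; first by rewrite /psum !big_ord0.
rewrite psumS IH -[uphalf n.+1]/(n./2.+1) uphalf_half; case: (boolP (odd n)) => on.
  by rewrite (u0 _ on) addr0.
by rewrite psumS add0n even_halfK.
Qed.

Lemma abs_sums_even u a : (forall n, odd n -> u n = 0) ->
  abs_sums (fun j => u j.*2) a -> abs_sums u a.
Proof.
move=> u0 [[M uM] ua]; split.
  by exists M => n; rewrite psum_even => [|k /u0 ->]; rewrite ?normr0.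
rewrite psum_even //; apply: cvg_comp ua.
move=> A [N _ NA]; exists N.*2 => // n /= Nn; apply: NA => /=.
by rewrite -(doubleK N) uphalfE half_leq // leqW.
Qed.

Definition term (f : fps) n : R := ratr (coef f n) * (1 / 4%:R) ^+ n.

Lemma term_mul f g : term (f * g) = conv (term f) (term g).
Proof.
apply/funext => n; rewrite /term /conv rmorph_sum /= mulr_suml; apply: eq_bigr => i _.
by rewrite rmorphM /= [RHS]mulrACA -exprD subnKC // -ltnS.
Qed.

(** * The coefficients of [sqrt(1 - z)], with [z = 4t] *)

Definition sval n := term sqrt_1m4t n.

Lemma sval0 : sval 0 = 1.
Proof. by rewrite /sval /term sqrt_1m4t0 rmorph1 mulr1. Qed.

Lemma svalS n : sval n.+1 = (n%:R - 2%:R^-1) / n.+1%:R * sval n.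
Proof.
have n0 : n.+1%:R != 0 :> R by rewrite pnatr_eq0.
rewrite /sval /term; have := sqrt_1m4t_rec n.
move: (coef sqrt_1m4t n.+1) (coef sqrt_1m4t n) => a b /(congr1 (ratr : rat -> R)).
rewrite !rmorphM rmorphB rmorphM /= !ratr_nat => E.
by apply: (mulfI n0); rewrite mulrA E exprS; field.
Qed.

Lemma sval_le0 n : sval n.+1 <= 0.
Proof.
elim: n => [|n IH]; rewrite svalS.
  by rewrite sval0 mulr1 divr1 sub0r oppr_le0.
rewrite mulr_ge0_le0 // divr_ge0 // subr_ge0.
by apply: (@le_trans _ _ 1); [lra|rewrite ler1n].
Qed.

(** Dividing by [1 - z] sums coefficients, and [(1 - z)^(-1/2)] is -2 times the derivative of
    [(1 - z)^(1/2)]. *)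
Lemma psum_sval n : psum sval n = - 2%:R * (n%:R * sval n).
Proof.
elim: n => [|n IH]; first by rewrite /psum big_ord0 mul0r mulr0.
have n0 : n.+1%:R != 0 :> R by rewrite pnatr_eq0.
by rewrite psumS IH svalS; field.
Qed.

(** From [n = 1] on, where it equals 1/4, the left side does not increase. This replaces the
    asymptotic order [n^(-3/2)] of the coefficients. *)
Lemma nsval_bound n : n%:R * (n%:R * sval n) ^+ 2 <= 4%:R^-1.
Proof.
elim: n => [|n IH]; first by rewrite mul0r invr_ge0.
case: n IH => [_|n IH]; first by rewrite svalS sval0; lra.
apply: le_trans IH; rewrite svalS.
have n0 : 0 <= n%:R :> R by [].
rewrite -(natr1 n.+1) -(natr1 n); set x := n%:R; set s := sval _.
have -> : (x + 1 + 1) * ((x + 1 + 1) * ((x + 1 - 2^-1) / (x + 1 + 1) * s)) ^+ 2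
  = (x + 2) * (x + 2^-1) ^+ 2 * s ^+ 2 by field; apply: lt0r_neq0; rewrite /x; lra.
have -> : (x + 1) * ((x + 1) * s) ^+ 2 = (x + 1) ^+ 3 * s ^+ 2 by ring.
rewrite ler_wpM2r ?sqr_ge0 //; rewrite -/x in n0; nra.
Qed.

Lemma inv_cvg0 : (fun n : nat => n.+1%:R^-1 : R) @ \oo --> (0 : R).
Proof. exact: cvg_harmonic. Qed.

Lemma nsval_sqr_bound n : (n.+1%:R * sval n.+1) ^+ 2 <= n.+1%:R^-1.
Proof.
have n0 : 0 < n.+1%:R :> R by [].
rewrite -(ler_pM2l n0) divff ?lt0r_neq0 //; apply: le_trans (nsval_bound _) _.
by rewrite invf_le1 ?ler1n.
Qed.

Lemma nsval_cvg0 : (fun n => n%:R * sval n) @ \oo --> (0 : R).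
Proof.
rewrite -(cvg_shiftn 1) /=; apply: norm_cvg0.
have h : (fun n : nat => Num.sqrt (n.+1%:R^-1 : R)) @ \oo --> (0 : R).
  rewrite -sqrtr0; apply: continuous_cvg; first exact: sqrt_continuous.
  exact: inv_cvg0.
apply: squeeze_cvgr (cvg_cst 0) h; near=> n; rewrite normr_ge0 /= addn1.
by rewrite -sqrtr_sqr ler_wsqrtr // nsval_sqr_bound.
Unshelve. all: by end_near.
Qed.

(** All coefficients but the first, 1, are nonpositive, so that the absolute sums are 2 minus the
    sums, and those are nonnegative by [psum_sval]. *)
Lemma sval_abs_sum n : psum (fun k => `|sval k|) n <= 2%:R.
Proof.
case: n => [|n]; first by rewrite /psum big_ord0.
have -> : psum (fun k => `|sval k|) n.+1 = 2%:R - psum sval n.+1.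
  elim: n => [|n IH]; last first.
    by rewrite psumS IH [psum sval n.+2]psumS ler0_norm ?sval_le0 // opprD addrA.
  by rewrite !psumS /psum !big_ord0 sval0 normr1; lra.
by rewrite psum_sval mulNr opprK gerDl mulr_ge0_le0 // mulr_ge0_le0 // sval_le0.
Qed.

Lemma abs_sums_sqrt : abs_sums (term sqrt_1m4t) 0.
Proof.
split; first by exists 2%:R; exact: sval_abs_sum.
rewrite (_ : psum _ = fun n => - 2%:R * (n%:R * sval n)); last first.
  by apply/funext => n; rewrite -psum_sval.
by rewrite -[X in _ --> X](mulr0 (- 2%:R)); apply: cvgM; [exact: cvg_cst|exact: nsval_cvg0].
Qed.

Lemma term_H1 j : term H1 j.*2 = sval j ^+ 2.
Proof.
by rewrite /term coef_H1 rmorphXn /= /sval /term [RHS]exprMn -[in RHS]exprM muln2.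
Qed.

Lemma term_H2 j : term H2 j.*2 = - 2%:R * (sval j * sval j.+1).
Proof.
rewrite /term coef_H2 /sval /term.
move: (coef sqrt_1m4t j.+1) (coef sqrt_1m4t j) => a b.
rewrite !rmorphM rmorphN fmorphV /= ratr_nat -addnn exprD exprS.
by field.
Qed.

Lemma term_odd f n : (forall k, odd k -> coef f k = 0) -> odd n -> term f n = 0.
Proof. by move=> h /h e; rewrite /term e rmorph0 mul0r. Qed.

Lemma sval_abs k : `|sval k| <= 2%:R.
Proof.
apply: le_trans (sval_abs_sum k.+1); rewrite psumS lerDr.
by apply: sumr_ge0 => i _; exact: normr_ge0.
Qed.

(** * Gauss's contiguity relation and the value of [H1] *)

(* [gauss k] sums the hypergeometric series of parameters -1/2, -1/2; k+1 at 1. *)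
Definition gauss_term k j := sval j ^+ 2 / 'C(k + j, j)%:R.

Lemma gauss_term_ge0 k j : 0 <= gauss_term k j.
Proof. by rewrite divr_ge0 // sqr_ge0. Qed.

Lemma gauss_term_le k j : gauss_term k j <= sval j ^+ 2.
Proof.
rewrite ler_pdivrMr ?ltr0n ?bin_gt0 ?leq_addl //.
by rewrite ler_peMr ?sqr_ge0 // ler1n bin_gt0 leq_addl.
Qed.

Lemma sval_sqr_sum n : psum (fun j => sval j ^+ 2) n <= 4%:R.
Proof.
apply: (@le_trans _ _ (2%:R * psum (fun k => `|sval k|) n)); last first.
  by have := sval_abs_sum n; lra.
rewrite /psum mulr_sumr; apply: ler_sum => i _.
by rewrite -(real_normK (num_real (sval i))) expr2 ler_wpM2r // sval_abs.
Qed.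

Lemma gauss_cvg k : exists l : R, psum (gauss_term k) @ \oo --> l.
Proof.
have [n|l [hl _]] := psum_cvg (gauss_term_ge0 k) (M := 4%:R); last by exists l.
apply: le_trans (sval_sqr_sum n); apply: ler_sum => i _; exact: gauss_term_le.
Qed.

Definition gauss k : R := xget 0 [set l | psum (gauss_term k) @ \oo --> l].

Lemma gauss_lim k : psum (gauss_term k) @ \oo --> gauss k.
Proof. by rewrite /gauss; case: xgetP => [l _ //|h]; have [l /h] := gauss_cvg k. Qed.

Lemma bin_shift k j : (k.+1 + j)%:R * 'C(k + j, j)%:R = k.+1%:R * 'C(k.+1 + j, j)%:R :> R.
Proof.
rewrite -!natrM; congr (_%:R); have := mul_bin_down (k.+1 + j) j.
by rewrite addSn /= -addSn addnK.
Qed.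

Lemma bin_shift2 k j : (k.+1 + j)%:R * 'C(k + j, j)%:R = j.+1%:R * 'C(k + j.+1, j.+1)%:R :> R.
Proof. by rewrite -!natrM; congr (_%:R); rewrite addnS -mul_bin_diag addSn. Qed.

(** The contiguity relation at 1 in finite form: the summands on the left telescope, and the right
    side is the boundary term. *)
Lemma gauss_telescope k n :
  k.+1%:R * k.+2%:R * psum (gauss_term k) n
  - (k%:R + 3%:R / 2%:R) ^+ 2 * psum (gauss_term k.+1) n
  = - (k.+1%:R * (n%:R * gauss_term k n)).
Proof.
have nz m : m.+1%:R != 0 :> R by rewrite pnatr_eq0.
have bz m j : 'C(m + j, j)%:R != 0 :> R by rewrite pnatr_eq0 -lt0n bin_gt0 leq_addl.
elim: n => [|n IH]; first by rewrite /psum !big_ord0 mul0r !mulr0 subrr oppr0.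
have e1 : gauss_term k.+1 n = k.+1%:R / (k.+1 + n)%:R * gauss_term k n.
  rewrite /gauss_term.
  have -> : 'C(k.+1 + n, n)%:R = (k.+1 + n)%:R * 'C(k + n, n)%:R / k.+1%:R :> R.
    by rewrite bin_shift mulrAC mulfV // mul1r.
  move: (k.+1%:R) (nz k) ((k.+1 + n)%:R) (nz (k + n)%N : (k.+1 + n)%:R != 0) ('C(k + n, n)%:R) (bz k n).
  by move=> x x0 y y0 z z0; field; rewrite x0 y0 z0.
have e2 : gauss_term k n.+1 =
    (n%:R - 2%:R^-1) ^+ 2 / (n.+1%:R * (k.+1 + n)%:R) * gauss_term k n.
  rewrite /gauss_term svalS.
  have -> : 'C(k + n.+1, n.+1)%:R = (k.+1 + n)%:R * 'C(k + n, n)%:R / n.+1%:R :> R.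
    by rewrite bin_shift2 mulrAC mulfV // mul1r.
  move: (n.+1%:R) (nz n) ((k.+1 + n)%:R) (nz (k + n)%N : (k.+1 + n)%:R != 0) ('C(k + n, n)%:R) (bz k n).
  by move=> x x0 y y0 z z0; field; rewrite x0 y0 z0.
rewrite !psumS [X in X - _]mulrDr [X in _ - X]mulrDr opprD addrACA IH e1 e2.
have E1 : k.+1%:R = k%:R + 1 :> R by rewrite natr1.
have E2 : k.+2%:R = k%:R + 1 + 1 :> R by rewrite !natr1.
have E3 : (k.+1 + n)%:R = k%:R + 1 + n%:R :> R by rewrite natrD E1.
have E4 : n.+1%:R = n%:R + 1 :> R by rewrite natr1.
have kn := nz (k + n)%N; have n1 := nz n; rewrite -addSn E3 in kn; rewrite E4 in n1.
by rewrite E3 E4 E2 E1; field; rewrite kn n1.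
Qed.

(** The boundary term of [gauss_telescope] vanishes in the limit, since
    [n s_n^2 <= (n s_n)^2 <= 1/n], where [s_n] is [sval n]. *)
Lemma gauss_rec k : k.+1%:R * k.+2%:R * gauss k = (k%:R + 3%:R / 2%:R) ^+ 2 * gauss k.+1.
Proof.
apply/eqP; rewrite -subr_eq0; apply/eqP.
have h : (fun n => k.+1%:R * k.+2%:R * psum (gauss_term k) n
  - (k%:R + 3%:R / 2%:R) ^+ 2 * psum (gauss_term k.+1) n) @ \oo -->
  k.+1%:R * k.+2%:R * gauss k - (k%:R + 3%:R / 2%:R) ^+ 2 * gauss k.+1.
  by apply: cvgB; apply: cvgM; first [exact: cvg_cst|exact: gauss_lim].
apply: (cvg_unique _ h) => //.
have -> : (fun n => k.+1%:R * k.+2%:R * psum (gauss_term k) n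
  - (k%:R + 3%:R / 2%:R) ^+ 2 * psum (gauss_term k.+1) n) =
  (fun n => - (k.+1%:R * (n%:R * gauss_term k n))).
  by apply/funext => n; exact: gauss_telescope.
rewrite /= -[X in _ --> X]oppr0; apply: cvgN; rewrite -[X in _ --> X](mulr0 k.+1%:R).
apply: cvgM; first exact: cvg_cst.
rewrite -(cvg_shiftn 1) /=.
apply: squeeze_cvgr (cvg_cst 0) inv_cvg0; near=> n; rewrite addn1.
rewrite mulr_ge0 ?gauss_term_ge0 //=; apply: le_trans (nsval_sqr_bound n).
rewrite exprMn; apply: ler_pM; rewrite ?gauss_term_ge0 ?gauss_term_le //.
by rewrite expr2 ler_peMr // ler1n.
Unshelve. all: by end_near.
Qed.

(** The term of index 0 is 1, and in all others the binomial denominator is at least [k + 1]; hence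
    [gauss k] tends to 1. *)
Lemma gauss_bounds k : 1 <= gauss k <= 1 + 4%:R / k.+1%:R.
Proof.
have k0 : 0 < k.+1%:R :> R by [].
apply/andP; split.
  apply: (cvgr_to_ge (@gauss_lim k)); near=> n.
  have n1 : (1 <= n)%N by near: n; exact: nbhs_infty_ge.
  apply: le_trans (psum_le (gauss_term_ge0 k) n1).
  by rewrite psumS /psum big_ord0 add0r /gauss_term sval0 expr1n addn0 bin0 divr1.
suff H n : psum (gauss_term k) n <= 1 + 4%:R / k.+1%:R.
  by apply: (cvgr_to_le (@gauss_lim k)); near=> n; exact: H.
have h j : gauss_term k j.+1 <= sval j.+1 ^+ 2 / k.+1%:R.
  rewrite /gauss_term ler_wpM2l ?sqr_ge0 // lef_pV2 ?posrE ?ltr0n ?bin_gt0 ?leq_addl //.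
  rewrite ler_nat addnS -addSn; elim: j => [|j IH]; first by rewrite addn0 bin1.
  by rewrite addnS binS (leq_trans IH) // leq_addl.
case: n => [|n]; first by rewrite /psum big_ord0 addr_ge0 // divr_ge0.
rewrite /psum big_ord_recl /= {1}/gauss_term sval0 expr1n addn0 bin0 divr1 lerD2l.
apply: (@le_trans _ _ (psum (fun j => sval j ^+ 2) n.+1 / k.+1%:R)); last first.
  by rewrite ler_pM2r ?invr_gt0 // sval_sqr_sum.
rewrite /psum big_ord_recl mulrDl -[leLHS]add0r lerD //.
  by rewrite divr_ge0 // sqr_ge0.
by rewrite mulr_suml; apply: ler_sum => i _; exact: h.
Unshelve. all: by end_near.
Qed.

Lemma gauss_prod k : gauss 0 = wallis_prod R k * gauss k.
Proof.
elim: k => [|k ->]; first by rewrite /wallis_prod big_ord0 mul1r.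
rewrite /wallis_prod big_ord_recr /= -mulrA; congr (_ * _).
have k0 : k.+1%:R * k.+2%:R != 0 :> R by rewrite mulf_neq0 // pnatr_eq0.
by apply: (mulfI k0); rewrite gauss_rec mulrA [X in _ = X * _]mulrC divfK.
Qed.

(** By [gauss_prod], [pi / 4 * gauss 0] is for every [k] the product of [pi / 4 * wallis_prod k] and
    [gauss k], both of which tend to 1. *)
Lemma gauss0 : gauss 0 = 4%:R / pi.
Proof.
have pi0 := pi_gt0 R.
suff E : pi / 4%:R * gauss 0 = 1.
  have F (x g : R) : 0 < x -> g = 4%:R / x * (x / 4%:R * g).
    by move=> x0; field; exact: lt0r_neq0.
  by rewrite (F _ (gauss 0) pi0) E mulr1.
have b k : 1 - k.+1%:R^-1 <= pi / 4%:R * gauss 0 <= 1 + 4%:R / k.+1%:R.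
  rewrite (gauss_prod k) mulrA; have /andP[w1 w2] := wallis_bounds R k.
  have /andP[g1 g2] := gauss_bounds k.
  have w0 : 0 <= pi / 4%:R * wallis_prod R k.
    by apply: le_trans w1; rewrite divr_ge0.
  apply/andP; split; last by rewrite -[leRHS]mul1r ler_pM // (le_trans _ g1).
  rewrite -[leLHS]mulr1; apply: ler_pM => //.
    by rewrite subr_ge0 invf_le1 ?ler1n.
  apply: le_trans w1.
  rewrite -(natr1 (2 * k).+2) -(natr1 (2 * k).+1) -(natr1 (2 * k)) natrM -(natr1 k).
  have : 0 <= k%:R :> R by [].
  move: (k%:R : R) => x x0.
  have -> : 1 - (x + 1)^-1 = x / (x + 1) by field; apply: lt0r_neq0; lra.
  rewrite ler_pdivrMr ?ltr_wpDl // mulrAC ler_pdivlMr; last by lra.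
  nra.
have c1 : (fun k : nat => 1 - k.+1%:R^-1 : R) @ \oo --> (1 : R).
  by rewrite -[X in _ --> X]subr0; apply: cvgB; [exact: cvg_cst|exact: inv_cvg0].
have c2 : (fun k : nat => 1 + 4%:R / k.+1%:R : R) @ \oo --> (1 : R).
  rewrite -[X in _ --> X]addr0; apply: cvgD; first exact: cvg_cst.
  by rewrite -[X in _ --> X](mulr0 4%:R); apply: cvgM; [exact: cvg_cst|exact: inv_cvg0].
apply/eqP; rewrite eq_le; apply/andP; split.
  by apply: (cvgr_to_ge c2); near=> k; have /andP[] := b k.
by apply: (cvgr_to_le c1); near=> k; have /andP[] := b k.
Unshelve. all: by end_near.
Qed.

Lemma sval_sqr_cvg : psum (fun j => sval j ^+ 2) @ \oo --> (4%:R / pi : R).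
Proof.
rewrite -gauss0 (_ : (fun j => _) = gauss_term 0); first exact: gauss_lim.
by apply/funext => j; rewrite /gauss_term add0n binn divr1.
Qed.

Lemma abs_sums_H1 : abs_sums (term H1) (4%:R / pi).
Proof.
apply: abs_sums_even => [n|]; first by apply: term_odd => k /= ->.
rewrite (_ : (fun j => _) = fun j => sval j ^+ 2); last by apply/funext => j; exact: term_H1.
split; last exact: sval_sqr_cvg.
exists 4%:R => n; rewrite (_ : (fun k => _) = fun k => sval k ^+ 2) ?sval_sqr_sum //.
by apply/funext => k; rewrite ger0_norm ?sqr_ge0.
Qed.

(** Another telescoping sum, with vanishing boundary term; since the terms of [H2] carry a factor
    -2, it yields the value 2/3 of that of [H1]. *)
Lemma sval_contiguous n : psum (fun j => sval j * sval j.+1) n =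
  - 3%:R^-1 * (psum (fun j => sval j ^+ 2) n + 2%:R * (n%:R * sval n ^+ 2)).
Proof.
elim: n => [|n IH]; first by rewrite /psum !big_ord0 mul0r !mulr0 addr0 mulr0.
have n0 : n.+1%:R != 0 :> R by rewrite pnatr_eq0.
by rewrite !psumS IH svalS; rewrite -natr1 in n0 *; field.
Qed.

Lemma abs_sums_H2 : abs_sums (term H2) (8%:R / (3%:R * pi)).
Proof.
apply: abs_sums_even => [n|]; first by apply: term_odd => k /= ->.
rewrite (_ : (fun j => _) = fun j => - 2%:R * (sval j * sval j.+1)); last first.
  by apply/funext => j; exact: term_H2.
split.
  exists 8%:R => n; apply: (@le_trans _ _ (4%:R * psum (fun k => `|sval k|) n)); last first.
    by have := sval_abs_sum n; lra.
  rewrite /psum mulr_sumr; apply: ler_sum => i _.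
  have := sval_abs i.+1; have := normr_ge0 (sval i).
  rewrite !normrM normrN normr_nat; move: `|sval i| `|sval i.+1| => a b; nra.
have -> : psum (fun j => - 2%:R * (sval j * sval j.+1)) = fun n =>
  2%:R / 3%:R * psum (fun j => sval j ^+ 2) n + 4%:R / 3%:R * (n%:R * sval n ^+ 2).
  apply/funext => n; rewrite /psum -mulr_sumr -/(psum (fun j => sval j * sval j.+1) n).
  by rewrite sval_contiguous /psum; field.
have -> : 8%:R / (3%:R * pi) = 2%:R / 3%:R * (4%:R / pi) + 4%:R / 3%:R * 0 :> R.
  by move: (pi : R) (lt0r_neq0 (pi_gt0 R)) => x x0; field.
apply: cvgD; apply: cvgM; try exact: cvg_cst; first exact: sval_sqr_cvg.
rewrite -(cvg_shiftn 1) /=.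
apply: squeeze_cvgr (cvg_cst 0) inv_cvg0; near=> n; rewrite addn1.
rewrite mulr_ge0 ?sqr_ge0 //=; apply: le_trans (nsval_sqr_bound n).
rewrite [leRHS]exprMn ler_wpM2r ?sqr_ge0 //.
by rewrite expr2 ler_peMr // ler1n.
Unshelve. all: by end_near.
Qed.

Lemma abs_sums_poly (q : {poly rat}) :
  abs_sums (term (fps_of_poly q)) (ratr q.[4%:R^-1]).
Proof.
have -> : ratr q.[4%:R^-1] = psum (term (fps_of_poly q)) (size q).
  rewrite horner_coef rmorph_sum; apply: eq_bigr => i _.
  by rewrite /term rmorphM rmorphXn fmorphV /= ratr_nat div1r.
apply: abs_sums_fin => n nq; rewrite /term /= nth_default // rmorph0 mul0r //.
Qed.

(** The square root has value 0, represented by the zero polynomial, while [H1] and [H2] of degree 2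
    give multiples of [1/pi]; products are fine because halves rounded down are superadditive. *)
Lemma fgen_value d f : fgen true d f -> exists p : {poly rat},
  (size p <= (d./2).+1)%N /\ abs_sums (term f) (map_poly ratr p).[1 / pi].
Proof.
elim=> {d f} [q||||d f g _ [p [sp hp]] _ [r [sr hr]]|d e f g _ [p [sp hp]] _ [r [sr hr]]|d e f de _ [p [sp hp]]].
- exists (q.[4%:R^-1])%:P; split; first by rewrite size_polyC leq_b1.
  by rewrite map_polyC hornerC; exact: abs_sums_poly.
- exists (4%:R *: 'X); split; first by rewrite (leq_trans (size_scale_leq _ _)) ?size_polyX.
  by rewrite map_polyZ map_polyX hornerZ hornerX /= ratr_nat mul1r; exact: abs_sums_H1.
- exists ((8%:R / 3%:R) *: 'X); split.
    by rewrite (leq_trans (size_scale_leq _ _)) ?size_polyX.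
  rewrite map_polyZ map_polyX hornerZ hornerX /= rmorphM fmorphV /= !ratr_nat mul1r.
  by rewrite -mulrA -invfM; exact: abs_sums_H2.
- exists 0; split; first by rewrite size_poly0.
  by rewrite map_poly0 horner0; exact: abs_sums_sqrt.
- exists (p + r); split.
    by apply: leq_trans (size_polyD _ _) _; rewrite geq_max sp.
  rewrite rmorphD hornerD /= (_ : term _ = fun n => term f n + term g n).
    exact: abs_sumsD.
  by apply/funext => n; rewrite /term rmorphD mulrDl.
- exists (p * r); split.
    apply: leq_trans (size_polyMleq _ _) _; rewrite -subn1 leq_subLR; lia.
  by rewrite rmorphM hornerM term_mul; exact: abs_sumsM.
exists p; split=> //; apply: leq_trans sp _; rewrite ltnS; exact: half_leq.
Qed.

Lemma coef_tM (f : fps) n :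
  coef (fps_of_poly 'X * f) n = if n is m.+1 then coef f m else 0.
Proof.
rewrite -[LHS]/(\sum_(i < n.+1) ('X : {poly rat})`_i * coef f (n - i)).
case: n => [|n]; first by rewrite big_ord1 coefX mul0r.
rewrite big_ord_recl coefX mul0r add0r big_ord_recl big1 => [|i _].
  by rewrite coefX mul1r addr0 subn1.
by rewrite coefX mul0r.
Qed.

Lemma psum_term_tM f n :
  psum (term (fps_of_poly 'X * f)) n.+1 = 4%:R^-1 * psum (term f) n.
Proof.
rewrite /psum big_ord_recl {1}/term coef_tM rmorph0 mul0r add0r mulr_sumr.
by apply: eq_bigr => i _; rewrite /term lift0 coef_tM exprS div1r mulrCA.
Qed.

Lemma psum_term_tXM f M n :
  psum (term (fps_of_poly 'X ^+ M * f)) (n + M) = 4%:R^-1 ^+ M * psum (term f) n.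
Proof.
elim: M => [|M IH]; first by rewrite !expr0 !mul1r addn0.
by rewrite addnS !exprS -!mulrA psum_term_tM IH.
Qed.
End Values.

(** Partial sums of the series are those of its product with [t^M], shifted by [M] and multiplied by
    [4^M]; so the convergence transfers back. *)
Lemma tree_value (R : realType) (T : dtree) : exists p : {poly rat},
  (size p <= ((num_nongray T)./2).+1)%N /\
  series (fun n : nat => ratr (coef (tree_series T) n) * (1 / 4%:R) ^+ n : R)
    @ \oo --> (map_poly ratr p).[1 / pi].
Proof.
have [M /(fgen_value R)[p [sp [_ hp]]]] := tree_fgen T.
exists ((4%:R ^+ M) *: p); split; first exact: leq_trans (size_scale_leq _ _) sp.
rewrite map_polyZ hornerZ /= rmorphXn /= ratr_nat.
have -> : series (fun n : nat => ratr (coef (tree_series T) n) * (1 / 4%:R) ^+ n : R) =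
    fun n => 4%:R ^+ M * psum (term R (fps_of_poly 'X ^+ M * tree_series T)) (n + M).
  apply/funext => n; rewrite psum_term_tXM mulrA -exprMn divff ?pnatr_eq0 // expr1n [RHS]mul1r.
  by rewrite seriesEord.
apply: cvgM; first exact: cvg_cst.
by rewrite -(cvg_shiftn M) in hp.
Qed.

Theorem theorem9 (R : realType) (T : dtree) :
  [/\ in_B (to_laurent (tree_series T)),
      vcmp (troot T) = CmpEq -> in_A (to_laurent (tree_series T)),
      exists d : nat,
        has_degB (to_laurent (tree_series T)) d /\ (d <= num_nongray T)%N
    & exists p : {poly rat},
        (size p <= ((num_nongray T)./2).+1)%N /\
        series (fun n : nat => ratr (coef (tree_series T) n) * (1 / 4%:R) ^+ n : R)
          @ \oo --> (map_poly ratr p).[1 / pi] ].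
Proof.
split; [exact: tree_in_B|exact: tree_in_A|exact: tree_degB|exact: tree_value].
Qed.
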